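(* Let $X$ be a projective manifold and let $\omega_0, \omega_1$ be two rational $1$-forms on $X$ such that $\omega_0 \wedge \omega_1 \neq 0$. Suppose that for every $(s:t) \in \mathbb P^1$ the $1$-form $s \omega_0 + t \omega_1$ is integrable, and let $\mathcal F_{(s:t)}$ be the codimension one foliation it defines. Then at least one of the following assertions holds: (1) There exist a projective surface $Y$, a dominant rational map $\pi : X \dashrightarrow Y$, and foliations $\mathcal G_{(s:t)}$ on $Y$ such that $\mathcal F_{(s:t)} = \pi^* \mathcal G_{(s:t)}$ for every $(s:t) \in \mathbb P^1$. (2) For every $(s:t) \in \mathbb P^1$, the foliation $\mathcal F_{(s:t)}$ is (singularly) transversely affine.
   Context: All manifolds are over $\mathbb C$. A (singular holomorphic) foliation $\mathcal F$ on a projective manifold $X$ is a pair $(T_{\mathcal F}, N^*_{\mathcal F})$ of subsheaves of $(T_X,\Omega^1_X)$ which are annihilators of each other and such that $T_{\mathcal F}$ is closed under Lie brackets. Its codimension is the generic rank of $N^*_{\mathcal F}$. A rational $1$-form $\omega$ is integrable if $\omega\wedge d\omega=0$. A non-zero integrable rational $1$-form $\omega$ defines the codimension one foliation whose tangent sheaf is the kernel of contraction $v\mapsto \omega(v)$. If $\pi: X\dashrightarrow Y$ is a dominant rational map and $\mathcal H$ is a codimension one foliation on $Y$ defined by a rational $1$-form $\beta$, then $\pi^*\mathcal H$ is the foliation on $X$ defined by $\pi^*\beta$. A codimension one foliation $\mathcal F$ on $X$ is (singularly) transversely affine if there exist a rational $1$-form $\alpha_0$ defining $\mathcal F$ and a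 closed rational $1$-form $\alpha_1$ such that $d\alpha_0 = \alpha_0\wedge\alpha_1$. *)

(* Defs.v *)
From HB Require Import structures.
From mathcomp Require Import all_boot all_order all_algebra.
From mathcomp Require Import generic_quotient.
From mathcomp Require Import mathcomp_extra boolp classical_sets reals.
From mathcomp Require Import complex.
From mathcomp Require Import mpoly.
From mathcomp Require Import ring.

Set Implicit Arguments.
Unset Strict Implicit.
Unset Printing Implicit Defensive.

Import Order.TTheory GRing.Theory Num.Theory.
Local Open Scope classical_set_scope.
Local Open Scope quotient_scope.
Local Open Scope ring_scope.

(* Everything is algebraic: on a projective manifold, rational forms, rational
   maps and coherent analytic subsheaves of T_X and Omega^1_X are algebraic by
   GAGA, so sheaves are taken in the Zariski topology.  The complex numbers
   are R[i], for R a model of the real numbers. *)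

Definition homogeneous (C : nzRingType) n (P : {mpoly C[n]}) : Prop :=
  exists d, P \is d.-homog.

(* A point of P^n is handled through its homogeneous coordinate vectors. *)
Definition proj_zeros (C : comNzRingType) n (E : set {mpoly C[n]}) :
    set ('I_n -> C) :=
  [set p | (exists i, p i <> 0) /\ forall P, E P -> P.@[p] = 0].

Record proj_variety (R : realType) := ProjVariety {
  pamb : nat;
  peqs : set {mpoly R[i][pamb.+1]};
  peqs_homog : forall P, peqs P -> homogeneous P;
  pnonempty : proj_zeros peqs !=set0;
  pirreducible : forall P Q, homogeneous P -> homogeneous Q ->
    (forall p, proj_zeros peqs p -> (P * Q).@[p] = 0) ->
    (forall p, proj_zeros peqs p -> P.@[p] = 0) \/
    (forall p, proj_zeros peqs p -> Q.@[p] = 0) }.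

Section Variety.
Variables (R : realType) (X : proj_variety R).

Definition hpoly := {mpoly R[i][(pamb X).+1]}.
Definition hvec := 'I_(pamb X).+1 -> R[i].
Definition pts : set hvec := proj_zeros (@peqs R X).
Definition vanishes (P : hpoly) : Prop := forall p, pts p -> P.@[p] = 0.

Record hfrac := HFrac {
  hdeg : nat;
  hnum : hpoly;
  hden : hpoly;
  hnum_homog : hnum \is hdeg.-homog;
  hden_homog : hden \is hdeg.-homog;
  hden_neq0 : ~ vanishes hden }.

HB.instance Definition _ := gen_eqMixin hfrac.
HB.instance Definition _ := gen_choiceMixin hfrac.

Definition hequiv (a b : hfrac) : bool :=
  `[< forall p, pts p ->
        (hnum a).@[p] * (hden b).@[p] = (hnum b).@[p] * (hden a).@[p] >].

Lemma vanishesM (P Q : hpoly) : homogeneous P -> homogeneous Q ->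
  vanishes (P * Q) -> vanishes P \/ vanishes Q.
Proof. exact: pirreducible. Qed.

Lemma hequiv_refl : reflexive hequiv.
Proof. by move=> a; apply/asboolP. Qed.

Lemma hequiv_sym : ssrbool.symmetric hequiv.
Proof. by move=> a b; apply/asboolP/asboolP => H p /H ->. Qed.

Lemma hequiv_trans : transitive hequiv.
Proof.
move=> b a c /asboolP Hab /asboolP Hbc; apply/asboolP => p Xp.
have hB (P Q : hpoly) d : P \is d.-homog -> Q \is d.-homog -> P - Q \is d.-homog.
  by move=> hP hQ; rewrite dhomogD // dhomogN.
have := @vanishesM (hden b) (hnum a * hden c - hnum c * hden a).
case.
- by exists (hdeg b); apply: hden_homog.
- exists (hdeg a + hdeg c)%N; apply: hB.
    by apply: dhomogM; [apply: hnum_homog|apply: hden_homog].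
  by rewrite addnC; apply: dhomogM; [apply: hnum_homog|apply: hden_homog].
- move=> q Xq; rewrite !(mevalM, mevalB); move: (Hab _ Xq) (Hbc _ Xq).
  move: ((hnum a).@[q]) ((hden a).@[q]) ((hnum b).@[q]) ((hden b).@[q]).
  move: ((hnum c).@[q]) ((hden c).@[q]) => c1 c2 a1 a2 b1 b2 H1 H2.
  have -> : b2 * (a1 * c2 - c1 * a2) = (a1 * b2) * c2 - (c1 * b2) * a2 by ring.
  by rewrite H1 -H2; ring.
- by move/(@hden_neq0 b).
- move/(_ p Xp); rewrite !(mevalM, mevalB) => /eqP.
  by rewrite subr_eq0 => /eqP.
Qed.

Canonical hequiv_equivRel := EquivRel hequiv hequiv_refl hequiv_sym hequiv_trans.

Definition ratfun := {eq_quot hequiv}.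
HB.instance Definition _ : EqQuotient _ hequiv ratfun := EqQuotient.on ratfun.
HB.instance Definition _ := Choice.on ratfun.

Definition rclass (a : hfrac) : ratfun := \pi a.

Lemma rclassP a b : rclass a = rclass b <-> hequiv a b.
Proof. by split => [/eqmodP|H]; last apply/eqmodP. Qed.

Lemma rclass_repr x : rclass (repr x) = x.
Proof. exact: reprK. Qed.

Lemma hden_neq0M (a b : hfrac) : ~ vanishes (hden a * hden b).
Proof.
move=> /vanishesM [].
- by exists (hdeg a); apply: hden_homog.
- by exists (hdeg b); apply: hden_homog.
- exact: hden_neq0.
- exact: hden_neq0.
Qed.

Lemma one_neq0 : ~ vanishes 1.
Proof.
have [p Xp] := pnonempty X.
by move=> /(_ p Xp); rewrite meval1 => /eqP; rewrite oner_eq0.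
Qed.

Lemma hconst_homog c : (c%:MP : hpoly) \is 0.-homog.
Proof. by rewrite -[_%:MP]mulr1 mul_mpolyC dhomogZ // dhomog1. Qed.

Definition hconst (c : R[i]) : hfrac :=
  HFrac (hconst_homog c) (dhomog1 _ _) one_neq0.

Definition hadd (a b : hfrac) : hfrac :=
  HFrac
    (dhomogD (dhomogM (hnum_homog a) (hden_homog b))
       (eq_ind _ (fun d => _ \is d.-homog)
          (dhomogM (hnum_homog b) (hden_homog a)) _ (addnC _ _)))
    (dhomogM (hden_homog a) (hden_homog b)) (@hden_neq0M a b).

Lemma hopp_homog (a : hfrac) : - hnum a \is (hdeg a).-homog.
Proof. by rewrite dhomogN hnum_homog. Qed.

Definition hopp (a : hfrac) : hfrac :=
  HFrac (hopp_homog a) (hden_homog a) (@hden_neq0 a).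

Definition hmul (a b : hfrac) : hfrac :=
  HFrac (dhomogM (hnum_homog a) (hnum_homog b))
    (dhomogM (hden_homog a) (hden_homog b)) (@hden_neq0M a b).

Definition hinv (a : hfrac) : hfrac :=
  match pselect (vanishes (hnum a)) with
  | left _ => hconst 0
  | right h => HFrac (hden_homog a) (hnum_homog a) h
  end.

Definition radd (x y : ratfun) : ratfun := rclass (hadd (repr x) (repr y)).
Definition ropp (x : ratfun) : ratfun := rclass (hopp (repr x)).
Definition rmul (x y : ratfun) : ratfun := rclass (hmul (repr x) (repr y)).
Definition rinv (x : ratfun) : ratfun := rclass (hinv (repr x)).
Definition rconst (c : R[i]) : ratfun := rclass (hconst c).

Lemma hequivP a b : reflect (forall p, pts p ->
    (hnum a).@[p] * (hden b).@[p] = (hnum b).@[p] * (hden a).@[p])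
  (hequiv a b).
Proof. exact: asboolP. Qed.

Lemma hrepr a : hequiv (repr (rclass a)) a.
Proof. by apply/rclassP; rewrite rclass_repr. Qed.

Lemma raddE a b : radd (rclass a) (rclass b) = rclass (hadd a b).
Proof.
apply/rclassP/hequivP => p Xp /=.
have /hequivP/(_ p Xp) := hrepr a; have /hequivP/(_ p Xp) := hrepr b.
rewrite !(mevalM, mevalD).
move: (repr (rclass a)) (repr (rclass b)) => a' b'.
set n1 := (hnum a).@[p]; set n2 := (hnum b).@[p]; set d1 := (hden a).@[p].
set d2 := (hden b).@[p]; set n3 := (hnum a').@[p]; set n4 := (hnum b').@[p].
set d3 := (hden a').@[p]; set d4 := (hden b').@[p] => H2 H1.
have -> : (n3 * d4 + n4 * d3) * (d1 * d2) =
          (n3 * d1) * (d4 * d2) + (n4 * d2) * (d3 * d1) by ring.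
by rewrite H1 H2; ring.
Qed.

Lemma rmulE a b : rmul (rclass a) (rclass b) = rclass (hmul a b).
Proof.
apply/rclassP/hequivP => p Xp /=.
have /hequivP/(_ p Xp) := hrepr a; have /hequivP/(_ p Xp) := hrepr b.
by rewrite !mevalM mulrACA => -> ->; rewrite mulrACA.
Qed.

Lemma roppE a : ropp (rclass a) = rclass (hopp a).
Proof.
apply/rclassP/hequivP => p Xp /=.
have /hequivP/(_ p Xp) := hrepr a.
by rewrite !mevalN !mulNr => ->.
Qed.

Lemma rind (P : ratfun -> Prop) : (forall a, P (rclass a)) -> forall x, P x.
Proof. by move=> H x; rewrite -[x]rclass_repr. Qed.

Lemma raddA : associative radd.
Proof.
elim/rind => a; elim/rind => b; elim/rind => c; rewrite !raddE.
by apply/rclassP/hequivP => p _ /=; rewrite !(mevalM, mevalD); ring.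
Qed.

Lemma raddC : commutative radd.
Proof.
elim/rind => a; elim/rind => b; rewrite !raddE.
by apply/rclassP/hequivP => p _ /=; rewrite !(mevalM, mevalD); ring.
Qed.

Lemma radd0 : left_id (rconst 0) radd.
Proof.
elim/rind => a; rewrite raddE.
apply/rclassP/hequivP => p _ /=.
by rewrite !(mevalM, mevalD, mevalC, meval1); ring.
Qed.

Lemma raddN : left_inverse (rconst 0) ropp radd.
Proof.
elim/rind => a; rewrite roppE raddE.
apply/rclassP/hequivP => p _ /=.
by rewrite !(mevalM, mevalD, mevalN, mevalC, meval1); ring.
Qed.

HB.instance Definition _ := GRing.isZmodule.Build ratfun raddA raddC radd0 raddN.

Lemma rmulA : associative rmul.
Proof.
elim/rind => a; elim/rind => b; elim/rind => c; rewrite !rmulE.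
by apply/rclassP/hequivP => p _ /=; rewrite !mevalM; ring.
Qed.

Lemma rmulC : commutative rmul.
Proof.
elim/rind => a; elim/rind => b; rewrite !rmulE.
by apply/rclassP/hequivP => p _ /=; rewrite !mevalM; ring.
Qed.

Lemma rmul1 : left_id (rconst 1) rmul.
Proof.
elim/rind => a; rewrite rmulE.
by apply/rclassP/hequivP => p _ /=; rewrite !(mevalM, mevalC, meval1); ring.
Qed.

Lemma rmulD : left_distributive rmul radd.
Proof.
elim/rind => a; elim/rind => b; elim/rind => c; rewrite !(raddE, rmulE).
by apply/rclassP/hequivP => p _ /=; rewrite !(mevalM, mevalD); ring.
Qed.

Lemma rone_neq0 : rconst 1 != rconst 0.
Proof.
apply/eqP => /rclassP/hequivP H; have [p /H /=] := pnonempty X.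
by rewrite !(mevalC, meval1) !mulr1 => /eqP; rewrite oner_eq0.
Qed.

HB.instance Definition _ :=
  GRing.Zmodule_isComNzRing.Build ratfun rmulA rmulC rmul1 rmulD rone_neq0.

Lemma rclass_eq0 a : vanishes (hnum a) <-> rclass a = 0.
Proof.
rewrite -[0]/(rclass (hconst 0)) rclassP; split => [H|/hequivP H p Xp].
  by apply/hequivP => p Xp /=; rewrite (H p Xp) !mevalC !mul0r.
by move: (H p Xp); rewrite /= !mevalC mulr1 mul0r.
Qed.

Lemma rmulV (x : ratfun) : x != 0 -> rmul (rinv x) x = 1.
Proof.
move=> /eqP x0; rewrite -[X in rmul _ X]rclass_repr rmulE /hinv.
case: pselect => [/rclass_eq0|h]; first by rewrite rclass_repr.
rewrite -[1]/(rclass (hconst 1)); apply/(rclassP _ (hconst 1))/hequivP => p _ /=.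
by rewrite !(mevalM, mevalC, meval1); ring.
Qed.

Lemma rinv0 : rinv 0 = 0.
Proof.
rewrite /rinv /hinv; case: pselect => // h; exfalso; apply: h.
by apply/rclass_eq0; rewrite rclass_repr.
Qed.

HB.instance Definition _ := GRing.ComNzRing_isField.Build ratfun rmulV rinv0.

Lemma rconst_zmod_morphism : zmod_morphism rconst.
Proof.
move=> c d; rewrite -[RHS]/(radd (rclass _) (ropp (rclass _))) roppE raddE.
apply/rclassP/hequivP => p _ /=.
by rewrite !(mevalM, mevalD, mevalN, mevalC, meval1); ring.
Qed.

Lemma rconst_monoid_morphism : monoid_morphism rconst.
Proof.
split=> // c d; rewrite -[RHS]/(rmul (rclass _) (rclass _)) rmulE.
by apply/rclassP/hequivP => p _ /=; rewrite !(mevalM, mevalC, meval1); ring.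
Qed.

HB.instance Definition _ :=
  GRing.isZmodMorphism.Build R[i] ratfun rconst rconst_zmod_morphism.
HB.instance Definition _ :=
  GRing.isMonoidMorphism.Build R[i] ratfun rconst rconst_monoid_morphism.
End Variety.

Section Forms.
Variables (R : realType) (X : proj_variety R).
Local Notation K := (ratfun X).

(* Rational vector fields on X are the derivations of C(X) over C. *)
Record vfield := VField {
  vapp :> K -> K;
  vappD : forall x y, vapp (x + y) = vapp x + vapp y;
  vappM : forall x y, vapp (x * y) = vapp x * y + x * vapp y;
  vappC : forall c, vapp (rconst X c) = 0 }.

HB.instance Definition _ := gen_eqMixin vfield.
HB.instance Definition _ := gen_choiceMixin vfield.

Lemma vfield_ext (v w : vfield) : v =1 w -> v = w.
Proof.
case: v w => [v vD vM vC] [w wD wM wC] /= /funext vw.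
move: vD vM vC; rewrite vw => vD vM vC.
by congr VField; apply: Prop_irrelevance.
Qed.

Program Definition vzero := @VField (fun=> 0) _ _ _.
Next Obligation. by rewrite addr0. Qed.
Next Obligation. by rewrite mul0r mulr0 addr0. Qed.

Program Definition vadd (v w : vfield) := @VField (fun x => v x + w x) _ _ _.
Next Obligation. by rewrite !vappD; ring. Qed.
Next Obligation. by rewrite !vappM; ring. Qed.
Next Obligation. by rewrite !vappC addr0. Qed.

Program Definition vopp (v : vfield) := @VField (fun x => - v x) _ _ _.
Next Obligation. by rewrite !vappD; ring. Qed.
Next Obligation. by rewrite !vappM; ring. Qed.
Next Obligation. by rewrite !vappC oppr0. Qed.

Program Definition vscale (f : K) (v : vfield) := @VField (fun x => f * v x) _ _ _.
Next Obligation. by rewrite !vappD; ring. Qed.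
Next Obligation. by rewrite !vappM; ring. Qed.
Next Obligation. by rewrite !vappC mulr0. Qed.

Program Definition bracket (v w : vfield) :=
  @VField (fun x => v (w x) - w (v x)) _ _ _.
Next Obligation. by rewrite !vappD; ring. Qed.
Next Obligation. by rewrite !(vappM, vappD); ring. Qed.
Next Obligation. by rewrite !vappC subr0. Qed.

Lemma vaddA : associative vadd.
Proof. by move=> u v w; apply: vfield_ext => x /=; rewrite addrA. Qed.
Lemma vaddC : commutative vadd.
Proof. by move=> u v; apply: vfield_ext => x /=; rewrite addrC. Qed.
Lemma vadd0 : left_id vzero vadd.
Proof. by move=> u; apply: vfield_ext => x /=; rewrite add0r. Qed.
Lemma vaddN : left_inverse vzero vopp vadd.
Proof. by move=> u; apply: vfield_ext => x /=; rewrite addNr. Qed.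
HB.instance Definition _ := GRing.isZmodule.Build vfield vaddA vaddC vadd0 vaddN.

Lemma vscaleA a b v : vscale a (vscale b v) = vscale (a * b) v.
Proof. by apply: vfield_ext => x /=; rewrite mulrA. Qed.
Lemma vscale1 : left_id 1 vscale.
Proof. by move=> v; apply: vfield_ext => x /=; rewrite mul1r. Qed.
Lemma vscaleDr : right_distributive vscale +%R.
Proof. by move=> a v w; apply: vfield_ext => x /=; rewrite mulrDr. Qed.
Lemma vscaleDl v : {morph vscale^~ v : a b / a + b}.
Proof. by move=> a b; apply: vfield_ext => x /=; rewrite mulrDl. Qed.
HB.instance Definition _ :=
  GRing.Zmodule_isLmodule.Build K vfield vscaleA vscale1 vscaleDr vscaleDl.

(* Rational 1-forms are the rational sections of the dual of the tangent
   bundle, i.e. the C(X)-linear functionals on rational vector fields. *)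
Record rform := Form {
  fapp :> vfield -> K;
  fappD : forall v w, fapp (v + w) = fapp v + fapp w;
  fappZ : forall f v, fapp (f *: v) = f * fapp v }.

HB.instance Definition _ := gen_eqMixin rform.
HB.instance Definition _ := gen_choiceMixin rform.

Lemma form_ext (v w : rform) : v =1 w -> v = w.
Proof.
case: v w => [v vD vZ] [w wD wZ] /= /funext vw.
move: vD vZ; rewrite vw => vD vZ.
by congr Form; apply: Prop_irrelevance.
Qed.

Program Definition fzero := @Form (fun=> 0) _ _.
Next Obligation. by rewrite addr0. Qed.
Next Obligation. by rewrite mulr0. Qed.

Program Definition fadd (a b : rform) := @Form (fun v => a v + b v) _ _.
Next Obligation. by rewrite !fappD; ring. Qed.
Next Obligation. by rewrite !fappZ; ring. Qed.

Program Definition fopp (a : rform) := @Form (fun v => - a v) _ _.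
Next Obligation. by rewrite !fappD; ring. Qed.
Next Obligation. by rewrite !fappZ; ring. Qed.

Program Definition fscale (f : K) (a : rform) := @Form (fun v => f * a v) _ _.
Next Obligation. by rewrite !fappD; ring. Qed.
Next Obligation. by rewrite !fappZ; ring. Qed.

Lemma faddA : associative fadd.
Proof. by move=> u v w; apply: form_ext => x /=; rewrite addrA. Qed.
Lemma faddC : commutative fadd.
Proof. by move=> u v; apply: form_ext => x /=; rewrite addrC. Qed.
Lemma fadd0 : left_id fzero fadd.
Proof. by move=> u; apply: form_ext => x /=; rewrite add0r. Qed.
Lemma faddN : left_inverse fzero fopp fadd.
Proof. by move=> u; apply: form_ext => x /=; rewrite addNr. Qed.
HB.instance Definition _ := GRing.isZmodule.Build rform faddA faddC fadd0 faddN.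

Lemma fscaleA a b v : fscale a (fscale b v) = fscale (a * b) v.
Proof. by apply: form_ext => x /=; rewrite mulrA. Qed.
Lemma fscale1 : left_id 1 fscale.
Proof. by move=> v; apply: form_ext => x /=; rewrite mul1r. Qed.
Lemma fscaleDr : right_distributive fscale +%R.
Proof. by move=> a v w; apply: form_ext => x /=; rewrite mulrDr. Qed.
Lemma fscaleDl v : {morph fscale^~ v : a b / a + b}.
Proof. by move=> a b; apply: form_ext => x /=; rewrite mulrDl. Qed.
HB.instance Definition _ :=
  GRing.Zmodule_isLmodule.Build K rform fscaleA fscale1 fscaleDr fscaleDl.

Program Definition dfun (f : K) := @Form (fun v => v f) _ _.

(* 2-forms and 3-forms only occur through their values on vector fields; wedge
   and d are normalised without factors 1/2, so that d(g dh) = dg /\ dh. *)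
Definition wedge11 (a b : rform) (v w : vfield) : K := a v * b w - a w * b v.

Definition dform (a : rform) (v w : vfield) : K :=
  v (a w) - w (a v) - a (bracket v w).

Definition wedge12 (a : rform) (B : vfield -> vfield -> K) (u v w : vfield) : K :=
  a u * B v w + a v * B w u + a w * B u v.

Definition integrable (a : rform) : Prop :=
  forall u v w, wedge12 a (dform a) u v w = 0.

Definition closed_form (a : rform) : Prop := forall v w, dform a v w = 0.

End Forms.

Section Foliation.
Variables (R : realType) (X : proj_variety R).
Local Notation K := (ratfun X).

Definition has_value (f : K) (p : hvec X) (c : R[i]) : Prop :=
  exists a : hfrac X,
    [/\ f = rclass a, (hden a).@[p] <> 0 & c = (hnum a).@[p] / (hden a).@[p]].

(* f belongs to the local ring of X at p. *)
Definition regular_at (p : hvec X) (f : K) : Prop := exists c, has_value f p c.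

(* Since X is irreducible and all the sheaves below are torsion free, it is
   enough to consider their sections over nonempty open sets, which are
   recorded as rational objects. *)
Record zopen := ZOpen {
  zset :> set (hvec X);
  zset_neq0 : zset !=set0;
  zset_open : exists2 E : set (hpoly X), (forall P, E P -> homogeneous P) &
    zset = [set p | pts p /\ exists2 P, E P & P.@[p] <> 0] }.

Definition regular_fun (U : zopen) (f : K) : Prop :=
  forall p, zset U p -> regular_at p f.

Definition regular_vfield (U : zopen) : set (vfield X) :=
  [set v | forall p, zset U p -> forall f, regular_at p f -> regular_at p (v f)].

(* Kaehler differentials modulo torsion: locally a combination of differentials g dh with g, h regular. *)
Definition regular_form (U : zopen) : set (rform X) :=
  [set a | forall p, zset U p -> exists m (g h : 'I_m -> K),
    (forall i, regular_at p (g i) /\ regular_at p (h i)) /\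
    a = \sum_i g i *: dfun (h i)].

(* Subsheaf of O_X-modules of a sheaf A of rational sections. *)
Definition subsheaf (V : lmodType K) (A S : zopen -> set V) : Prop :=
  [/\ forall U, S U `<=` A U,
      forall U, S U 0 /\ forall f x y, regular_fun U f -> S U x -> S U y ->
        S U (f *: x + y),
      forall U U' : zopen, U' `<=` U -> S U `<=` S U' &
      forall (U : zopen) (I : Type) (W : I -> zopen) x,
        U = \bigcup_i W i :> set _ -> (forall i, S (W i) x) -> S U x].

(* fol_T and fol_N are annihilators of each other in the sense of sheaves.  The
   definition does not require X to be smooth. *)
Record foliation := Foliation {
  fol_T : zopen -> set (vfield X);
  fol_N : zopen -> set (rform X);
  fol_T_sub : subsheaf regular_vfield fol_T;
  fol_N_sub : subsheaf regular_form fol_N;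
  fol_T_ann : forall U v, fol_T U v <-> regular_vfield U v /\
    forall (U' : zopen) a, U' `<=` U -> fol_N U' a -> a v = 0;
  fol_N_ann : forall U a, fol_N U a <-> regular_form U a /\
    forall (U' : zopen) v, U' `<=` U -> fol_T U' v -> a v = 0;
  fol_bracket : forall U v w, fol_T U v -> fol_T U w -> fol_T U (bracket v w) }.

(* The generic stalk of the conormal sheaf has dimension q over C(X). *)
Definition codimension (F : foliation) (q : nat) : Prop :=
  exists e : 'I_q -> rform X,
    [/\ forall i, exists U, fol_N F U (e i),
        forall c : 'I_q -> K, \sum_i c i *: e i = 0 -> forall i, c i = 0 &
        forall U a, fol_N F U a -> exists c : 'I_q -> K, a = \sum_i c i *: e i].

(* fol_T is the kernel of contraction with a; by fol_N_ann it determines F. *)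
Definition defines (a : rform X) (F : foliation) : Prop :=
  [/\ a <> 0, integrable a, codimension F 1 &
      forall U v, fol_T F U v <-> regular_vfield U v /\ a v = 0].

Definition transversely_affine (F : foliation) : Prop :=
  exists a0 a1 : rform X,
    [/\ defines a0 F, closed_form a1 & dform a0 = wedge11 a0 a1].

Definition alg_independent d (x : 'I_d -> K) : Prop :=
  forall P : {mpoly R[i][d]}, (map_mpoly (rconst X) P).@[x] = 0 -> P = 0.

(* Transcendence degree of C(X) over C. *)
Definition dimension (d : nat) : Prop :=
  (exists x : 'I_d -> K, alg_independent x) /\
  (forall x : 'I_d.+1 -> K, ~ alg_independent x).

(* Jacobian criterion: at each point the tangent space of the affine cone, cut out by the
   differentials of the equations vanishing on X, has dimension dim X + 1. *)
Definition smooth : Prop :=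
  exists2 d, dimension d &
    forall p, pts p -> exists2 W : 'M[R[i]]_(d.+1, (pamb X).+1), row_free W &
      forall w : 'rV_(pamb X).+1, (w <= W)%MS <->
        forall P : hpoly X, homogeneous P -> vanishes P ->
          \sum_i w 0 i * (mderiv i P).@[p] = 0.

End Foliation.

Section RationalMap.
Variables (R : realType) (X Y : proj_variety R).

(* The tuple f of rational functions on X, taken as homogeneous coordinates,
   is defined at p and sends p to q. *)
Definition sends (f : 'I_(pamb Y).+1 -> ratfun X) (p : hvec X) (q : hvec Y) : Prop :=
  [/\ pts p, exists i, q i <> 0 &
      exists g : ratfun X, forall i, has_value (g * f i) p (q i)].

Record ratmap := RatMap {
  rcoord :> 'I_(pamb Y).+1 -> ratfun X;
  rcoord_neq0 : exists i, rcoord i <> 0;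
  rcoord_pts : forall p q, sends rcoord p q -> pts q }.

(* The image is Zariski dense in Y. *)
Definition dominant (f : ratmap) : Prop :=
  forall P : hpoly Y, homogeneous P ->
    (forall p q, sends f p q -> P.@[q] = 0) -> vanishes P.

Definition heval (f : ratmap) (P : hpoly Y) : ratfun X :=
  (map_mpoly (rconst X) P).@[f].

Definition pullback_fun (f : ratmap) (x : ratfun Y) (y : ratfun X) : Prop :=
  exists a : hfrac Y,
    [/\ x = rclass a, heval f (hden a) <> 0 &
        y = heval f (hnum a) / heval f (hden a)].

(* The pullback of sum_i g_i dh_i is sum_i (f^* g_i) d(f^* h_i). *)
Definition pullback_form (f : ratmap) (b : rform Y) (a : rform X) : Prop :=
  exists m (g h : 'I_m -> ratfun Y) (g' h' : 'I_m -> ratfun X),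
    [/\ forall i, pullback_fun f (g i) (g' i) /\ pullback_fun f (h i) (h' i),
        b = \sum_i g i *: dfun (h i) & a = \sum_i g' i *: dfun (h' i)].

Definition is_pullback (f : ratmap) (G : foliation Y) (F : foliation X) : Prop :=
  exists b a, [/\ defines b G, pullback_form f b a & defines a F].

End RationalMap.

(* Families indexed by the projective line; the value at (0, 0) is junk. *)
Record p1_family (R : realType) (A : Type) := P1Family {
  p1_app :> R[i] -> R[i] -> A;
  p1_hom : forall c s t, c <> 0 -> p1_app (c * s) (c * t) = p1_app s t }.

Definition p1_point (R : realType) (s t : R[i]) : Prop := s <> 0 \/ t <> 0.

(* Main.v *)
(* The integrability of w0, w1 and w0 + w1 yields a common connection form theta with
   dw = theta /\ w for every member w of the pencil, and d theta = f w0 /\ w1.  If f = 0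
   every member is transversely affine through - theta.  Otherwise let k be the field of
   rational functions g with dg /\ w0 /\ w1 = 0.

   If dg /\ dh <> 0 for some g, h in k, the coefficients of w0 and w1 in the frame dg, dh
   are, up to a common factor, elements of k.  These coefficients together with g and h
   define the rational map to a surface from which the whole pencil is pulled back.

   If dg /\ dh = 0 for all g, h in k, then k contains a non constant h: otherwise the
   functions A_i^2 / f^3, where df + 2 f theta = A_0 w0 + A_1 w1, would be constant, which
   forces f = 0.  Modulo a member w of the pencil, theta is then -1/2 df/f + c dh with c in
   k, which is closed, unless w is itself a multiple of dh. *)
From HB Require Import structures.
Require Import Defs.
From mathcomp Require Import all_boot all_order all_algebra.
From mathcomp Require Import boolp classical_sets reals complex mpoly.
From mathcomp Require Import ring.

Set Implicit Arguments.
Unset Strict Implicit.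
Unset Printing Implicit Defensive.

Import GRing.Theory.
Local Open Scope ring_scope.

(** * Vector fields and forms *)

Lemma quotient_rule (F : fieldType) (x y z dx dy : F) : y != 0 ->
  z * y + x / y * dy = dx -> z = (dx * y - x * dy) / (y * y).
Proof. by move=> y0 <-; field. Qed.

Section Derivations.
Variables (R : realType) (X : proj_variety R).
Local Notation K := (ratfun X).
Implicit Types (u v w : vfield X) (a b : rform X) (f g x y : K).

Lemma vapp0 v : v 0 = 0.
Proof. by rewrite -(rmorph0 (rconst X)) vappC. Qed.

Lemma vapp1 v : v 1 = 0.
Proof. by rewrite -(rmorph1 (rconst X)) vappC. Qed.

Lemma vappN v x : v (- x) = - v x.
Proof. by apply/eqP; rewrite -addr_eq0 -vappD addNr vapp0. Qed.

Lemma vappB v x y : v (x - y) = v x - v y.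
Proof. by rewrite vappD vappN. Qed.

Lemma vappMn v x n : v (x *+ n) = v x *+ n.
Proof. by elim: n => [|n IHn]; rewrite ?mulr0n ?vapp0 // !mulrS vappD IHn. Qed.

Lemma vapp_div v x y : y != 0 -> v (x / y) = (v x * y - x * v y) / (y * y).
Proof. by move=> y0; apply: quotient_rule => //; rewrite -vappM divfK. Qed.

Lemma vaddE v w x : (v + w) x = v x + w x. Proof. by []. Qed.
Lemma voppE v x : (- v) x = - v x. Proof. by []. Qed.
Lemma vzeroE x : (0 : vfield X) x = 0. Proof. by []. Qed.
Lemma vscaleE f v x : (f *: v) x = f * v x. Proof. by []. Qed.
Lemma bracketE v w x : bracket v w x = v (w x) - w (v x). Proof. by []. Qed.
Lemma faddE a b v : (a + b) v = a v + b v. Proof. by []. Qed.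
Lemma foppE a v : (- a) v = - a v. Proof. by []. Qed.
Lemma fzeroE v : (0 : rform X) v = 0. Proof. by []. Qed.
Lemma fscaleE f a v : (f *: a) v = f * a v. Proof. by []. Qed.
Lemma dfunE f v : dfun f v = v f. Proof. by []. Qed.

Lemma fapp0 a : a 0 = 0.
Proof. by rewrite -(scale0r 0) fappZ mul0r. Qed.

Lemma fappN a v : a (- v) = - a v.
Proof. by rewrite -scaleN1r fappZ mulN1r. Qed.

Lemma fappB a v w : a (v - w) = a v - a w.
Proof. by rewrite fappD fappN. Qed.

Lemma dformD a b v w : dform (a + b) v w = dform a v w + dform b v w.
Proof. by rewrite /dform !faddE !vappD; ring. Qed.

Lemma dformZ f a v w :
  dform (f *: a) v w = v f * a w - w f * a v + f * dform a v w.
Proof. by rewrite /dform !fscaleE !vappM; ring. Qed.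

Lemma dform_dfun f v w : dform (dfun f) v w = 0.
Proof. by rewrite /dform !dfunE bracketE; ring. Qed.

Lemma dform_constZ c a v w :
  dform (rconst X c *: a) v w = rconst X c * dform a v w.
Proof. by rewrite dformZ !vappC; ring. Qed.

Lemma integrableZ f a : integrable a -> integrable (f *: a).
Proof.
move=> ia u v w; rewrite -[RHS](mulr0 (f * f)) -(ia u v w).
by rewrite /wedge12 !dformZ !fscaleE; ring.
Qed.

(** This is d(da) = 0. Second derivatives cancel in the expansion, and what remains is [a] applied
    to the Jacobi sum, which [J] shows to vanish. *)
Lemma ddform a u v w :
  u (dform a v w) + v (dform a w u) + w (dform a u v)
  - dform a (bracket u v) w - dform a (bracket v w) u - dform a (bracket w u) v
  = 0.
Proof.
have J : a (bracket (bracket u v) w) + a (bracket (bracket v w) u)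
   + a (bracket (bracket w u) v) = 0.
  rewrite -!fappD -(fapp0 a); congr (a _); apply: vfield_ext => x.
  by rewrite !vaddE !bracketE !vappB vzeroE; ring.
rewrite /dform !vappB !bracketE.
rewrite -[RHS]J; ring.
Qed.

End Derivations.

(** The identity theta = - (1/2 df/f - c dh) + e w of [affine_pencil] on one vector field: [x0],
    [x1] are the values of w0, w1, and an index 0 or 1 on [f], [h], [th] refers to the dual frame.
    The fractions over [D] come from Cramer's rule for (df + 2 f theta) / (2 f) in the basis dh,
    w. *)
Lemma pencil_identity (F : fieldType)
    (f g h0 h1 s t x0 x1 f0 f1 th0 th1 th D : F) :
  (2 : F) != 0 -> f != 0 -> h0 * t - h1 * s != 0 ->
  D = 2 * (f * (h0 * t - h1 * s)) ->
  th = - (2^-1 * (f^-1 * (x0 * f0 + x1 * f1 - 2 * (th - x0 * th0 - x1 * th1) * f))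
          - ((f0 + 2 * th0 * f) * t - (f1 + 2 * th1 * f) * s) / D
            * (x0 * h0 + x1 * h1))
       + ((f1 + 2 * th1 * f) * h0 - (f0 + 2 * th0 * f) * h1) / D
         * (s * x0 + t * x1).
Proof. by move=> n2 nf ng ->; field; rewrite nf ng. Qed.

Section Contraction.
Variables (R : realType) (X : proj_variety R).
Local Notation K := (ratfun X).

Lemma natr_ratfun_neq0 n : n.+1%:R != 0 :> K.
Proof. by rewrite -(rmorph_nat (rconst X)) fmorph_eq0 Num.Theory.pnatr_eq0. Qed.

Lemma bracketDl (u v w : vfield X) : bracket (u + v) w = bracket u w + bracket v w.
Proof. by apply: vfield_ext => x; rewrite !(vaddE, bracketE) vappD; ring. Qed.

Lemma bracketZl f (v w : vfield X) : bracket (f *: v) w = f *: bracket v w - w f *: v.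
Proof.
apply: vfield_ext => x.
by rewrite vaddE voppE !(bracketE, vscaleE) vappM; ring.
Qed.

Program Definition contract (a : rform X) (w : vfield X) : rform X :=
  @Form _ _ (fun v => dform a v w) _ _.
Next Obligation.
by rewrite /dform bracketDl !(fappD, vappD, vaddE); ring.
Qed.
Next Obligation.
by rewrite /dform bracketZl !(fappB, vappM, vscaleE, fappZ); ring.
Qed.

Lemma dformC (a : rform X) v w : dform a v w = - dform a w v.
Proof.
rewrite /dform; have -> : bracket v w = - bracket w v.
  by apply: vfield_ext => x; rewrite voppE !bracketE; ring.
by rewrite fappN; ring.
Qed.

Lemma closed_dlog (f : K) : f != 0 -> closed_form (f^-1 *: dfun f).
Proof.
move=> f0 v w; rewrite dformZ dform_dfun !dfunE -[f^-1]mul1r !vapp_div //.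
by rewrite !vapp1; ring.
Qed.

End Contraction.

(** * Derivations and algebraic independence *)

Section Polynomials.

Lemma mpoly_ind_ring n (R : nzRingType) (Q : {mpoly R[n]} -> Prop) :
  (forall c, Q c%:MP) -> (forall i, Q 'X_i) ->
  (forall p q, Q p -> Q q -> Q (p + q)) -> (forall p q, Q p -> Q q -> Q (p * q)) ->
  forall p, Q p.
Proof.
move=> QC QX QD QM; elim/mpolyind => [|c m p _ _ Qp]; first exact: QC.
apply: QD => //; rewrite -mul_mpolyC; apply: (QM); first exact: QC.
rewrite mpolyXE_id; apply: (big_ind Q) => [|p1 p2|i _] /=; first exact: (QC 1).
  exact: QM.
by elim: (m i) => [|k IH]; rewrite ?expr0 ?exprS; [exact: (QC 1)|exact: QM].
Qed.

Lemma mderivXU n (R : nzRingType) (i j : 'I_n) :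
  ('X_j : {mpoly R[n]})^`M(i) = (i == j)%:R%:MP.
Proof.
rewrite mderivX mnm1E eq_sym; case: eqP => [->|_]; last by rewrite scale0r mpolyC0.
by rewrite -{1}[U_(_)%MM]add0m addmK mpolyX0 scale1r mpolyC1.
Qed.

Lemma msize_mderiv_lt n (R : nzRingType) (p : {mpoly R[n]}) i :
  p != 0 -> (msize (p^`M(i)) < msize p)%N.
Proof.
move=> p0; rewrite -msize_poly_eq0 in p0; case E: (msize p) p0 => [//|k] _.
rewrite ltnS msizeE; apply/bigmax_leqP_seq => m; rewrite mcoeff_msupp mcoeff_mderiv.
move=> H _; have : (m + U_(i))%MM \in msupp p.
  by rewrite mcoeff_msupp; apply: contraNneq H => ->; rewrite mul0rn.
by move/msize_mdeg_lt; rewrite mdegD mdeg1 addn1 E.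
Qed.

(** The coefficient of a monomial m with m_i > 0 can be read off the i-th partial derivative, up to
    the factor m_i, which is nonzero in characteristic zero. *)
Lemma mderiv_eq0 n (R : idomainType) (p : {mpoly R[n]}) :
  (forall k, k.+1%:R != 0 :> R) ->
  (forall i, p^`M(i) = 0) -> p = (p@_0)%:MP.
Proof.
move=> ch0 p0; apply/mpolyP => m; rewrite mcoeffC.
have [<-|m0] := eqVneq 0%MM m; first by rewrite mulr1.
rewrite mulr0; have [i mi] : exists i, m i != 0%N.
  apply: contrapT => H; case/eqP: m0; apply/esym/mnmP => i; rewrite mnm0E.
  by apply/eqP/negP => /negP mi; apply: H; exists i.
have := congr1 (mcoeff (m - U_(i))%MM) (p0 i).
rewrite mcoeff_mderiv mcoeff0 submK; last first.
  by apply/mnm_lepP => j; rewrite mnm1E; case: eqP => // <-; rewrite lt0n.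
by rewrite -mulr_natr => /eqP; rewrite mulf_eq0 (negPf (ch0 _)) orbF => /eqP.
Qed.

End Polynomials.

(* Locked because unification would otherwise unfold polynomial evaluation. *)
HB.lock Definition keval (R : realType) (X : proj_variety R) n
  (x : 'I_n -> ratfun X) (P : {mpoly R[i][n]}) : ratfun X :=
  (map_mpoly (rconst X) P).@[x].

Section Evaluation.
Variables (R : realType) (X : proj_variety R).
Local Notation K := (ratfun X).

Variables (n : nat) (x : 'I_n -> K).

Lemma kevalD : {morph keval x : p q / p + q}.
Proof. by move=> p q; rewrite keval.unlock rmorphD mevalD. Qed.

Lemma kevalB : {morph keval x : p q / p - q}.
Proof. by move=> p q; rewrite keval.unlock rmorphB mevalB. Qed.

Lemma kevalM : {morph keval x : p q / p * q}.
Proof. by move=> p q; rewrite keval.unlock rmorphM mevalM. Qed.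

Lemma kevalC c : keval x c%:MP = rconst X c.
Proof. by rewrite keval.unlock map_mpolyC mevalC. Qed.

Lemma kevalX i : keval x 'X_i = x i.
Proof. by rewrite keval.unlock map_mpolyX mevalXU. Qed.

Lemma keval0 : keval x 0 = 0.
Proof. by rewrite -mpolyC0 kevalC rmorph0. Qed.

Lemma keval1 : keval x 1 = 1.
Proof. by rewrite -mpolyC1 kevalC rmorph1. Qed.

Lemma alg_independentE : alg_independent x <-> forall P, keval x P = 0 -> P = 0.
Proof. by rewrite keval.unlock. Qed.

Lemma vapp_keval (v : vfield X) P :
  v (keval x P) = \sum_i keval x (P^`M(i)) * v (x i).
Proof.
elim/mpoly_ind_ring: P => [c|j|p q hp hq|p q hp hq].
- rewrite kevalC vappC big1 // => i _.
  by rewrite mderivC keval0 mul0r.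
- rewrite kevalX (bigD1 j) //= mderivXU eqxx mpolyC1 keval1 mul1r big1 ?addr0 //.
  by move=> i /negPf ij; rewrite mderivXU ij mpolyC0 keval0 mul0r.
- rewrite kevalD vappD hp hq -big_split; apply: eq_bigr => i _ /=.
  by rewrite mderivD kevalD mulrDl.
rewrite kevalM vappM hp hq mulr_suml mulr_sumr -big_split; apply: eq_bigr => i _ /=.
by rewrite mderivM kevalD !kevalM; ring.
Qed.

(** The partial derivatives of a relation, evaluated at [x], serve as coefficients. If they all
    vanish, a nonzero partial derivative is a shorter relation; the descent ends because a nonzero
    constant is not a relation. *)
Lemma alg_dep_dfun : ~ alg_independent x ->
  exists2 c : 'I_n -> K, exists i, c i != 0 &
    forall v : vfield X, \sum_i c i * v (x i) = 0.
Proof.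
move=> dep.
have [P [P0 Px]] : exists P, P != 0 /\ keval x P = 0.
  apply: contrapT => H; apply: dep => P Px; apply/eqP/negP => /negP P0.
  by apply: H; exists P; rewrite keval.unlock.
have [k lek] := ubnP (msize P); elim: k => // k IH in P P0 Px lek *.
have [[i ci]|all0] := pselect (exists i, keval x (P^`M(i)) != 0).
  exists (fun i => keval x (P^`M(i))); first by exists i.
  by move=> v; rewrite -vapp_keval Px vapp0.
have {}all0 i : keval x (P^`M(i)) = 0.
  by apply/eqP/negP => /negP H; apply: all0; exists i.
have [[i Pi]|alld] := pselect (exists i, P^`M(i) != 0).
  apply: (IH _ Pi (all0 i)).
  by apply: leq_trans (msize_mderiv_lt i P0) _; rewrite -ltnS.
have EP : P = (P@_0)%:MP.
  apply: mderiv_eq0 => [m|i]; first by rewrite Num.Theory.pnatr_eq0.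
  by apply/eqP/negP => /negP H; apply: alld; exists i.
move: Px; rewrite EP kevalC => /eqP; rewrite fmorph_eq0 => /eqP c0.
by rewrite EP c0 mpolyC0 eqxx in P0.
Qed.

End Evaluation.

(** * Extension of derivations from a subring to the function field *)

Section DerivationExtension.
Variables (R : realType) (X : proj_variety R).
Local Notation K := (ratfun X).
Local Open Scope classical_set_scope.

(* A derivation of a subring of K into K, given by its graph. *)
Definition deriv_graph (G : set (K * K)) : Prop :=
  [/\ forall c, G (rconst X c, 0),
      forall x a y b, G (x, a) -> G (y, b) -> G (x + y, a + b),
      forall x a y b, G (x, a) -> G (y, b) -> G (x * y, a * y + x * b) &
      forall x a b, G (x, a) -> G (x, b) -> a = b].

Section Extend.
Variables (G : set (K * K)) (y : K).
Hypothesis hG : deriv_graph G.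

Let G0 : G (0, 0).
Proof. by case: hG => Gc _ _ _; move: (Gc 0); rewrite rmorph0. Qed.

Let GB x a x' b : G (x, a) -> G (x', b) -> G (x - x', a - b).
Proof.
case: hG => Gc GD GM _ h1 h2; apply: GD => //.
have := GM _ _ _ _ (Gc (-1)) h2.
by rewrite rmorphN1 !mulN1r mul0r add0r.
Qed.

Let Gsum (I : Type) (r : seq I) (F F' : I -> K) :
  (forall i, G (F i, F' i)) -> G (\sum_(i <- r) F i, \sum_(i <- r) F' i).
Proof.
case: hG => _ GD _ _ GF; elim: r => [|i r IH]; first by rewrite !big_nil.
by rewrite !big_cons; apply: GD.
Qed.

(** Here [q] is [p] with the derivation applied to its coefficients; in particular the coefficients
    of [p] lie in the domain of [G]. *)
Definition coef_graph (p q : {poly K}) := forall i, G (p`_i, q`_i).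

Lemma coef_graphB p q p' q' :
  coef_graph p q -> coef_graph p' q' -> coef_graph (p - p') (q - q').
Proof. by move=> h h' i; rewrite !coefB; apply: GB. Qed.

Lemma coef_graphD p q p' q' :
  coef_graph p q -> coef_graph p' q' -> coef_graph (p + p') (q + q').
Proof. by case: hG => _ GD _ _ h h' i; rewrite !coefD; apply: GD. Qed.

Lemma coef_graphM p q p' q' :
  coef_graph p q -> coef_graph p' q' -> coef_graph (p * p') (q * p' + p * q').
Proof.
case: hG => _ _ GM _ h h' i; rewrite coefD !coefM -big_split /=.
by apply: Gsum => j; apply: GM.
Qed.

Lemma coef_graphC x a : G (x, a) -> coef_graph x%:P a%:P.
Proof. by move=> h i; rewrite !coefC; case: eqP. Qed.

Lemma coef_graphXn k : coef_graph 'X^k 0.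
Proof.
case: hG => Gc _ _ _ i; rewrite coefXn coef0.
by have := Gc (i == k)%:R; rewrite rmorph_nat.
Qed.

Lemma coef_graph_deriv p q : coef_graph p q -> coef_graph p^`() q^`().
Proof.
case: hG => _ GD _ _ h i; rewrite !coef_deriv.
have GMn x a m : G (x, a) -> G (x *+ m, a *+ m).
  by move=> hx; elim: m => [|m IH]; rewrite ?mulr0n // !mulrS; apply: GD.
exact: GMn.
Qed.

(** The value forced at [p.[y]] by the Leibniz rule once [y] is sent to [u]. *)
Definition deriv_value u (p q : {poly K}) : K := q.[y] + p^`().[y] * u.

Lemma deriv_valueM u p q p' q' :
  deriv_value u (p * p') (q * p' + p * q') =
  deriv_value u p q * p'.[y] + p.[y] * deriv_value u p' q'.
Proof. by rewrite /deriv_value derivM !(hornerD, hornerM); ring. Qed.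

Lemma deriv_valueD u p q p' q' :
  deriv_value u (p + p') (q + q') = deriv_value u p q + deriv_value u p' q'.
Proof. by rewrite /deriv_value derivD !hornerD; ring. Qed.

Lemma deriv_valueB u p q p' q' :
  deriv_value u (p - p') (q - q') = deriv_value u p q - deriv_value u p' q'.
Proof. by rewrite /deriv_value derivB !(hornerD, hornerN); ring. Qed.

(* The value at y is forced by a relation of least degree, if there is one. *)
Lemma deriv_value_exists : exists u, forall p q,
  coef_graph p q -> p.[y] = 0 -> deriv_value u p q = 0.
Proof.
have [_ _ _ Gfun] := hG.
have zero u q : coef_graph 0 q -> deriv_value u 0 q = 0.
  move=> h; have -> : q = 0.
    by apply/polyP => i; rewrite coef0; apply: Gfun (h i) _; rewrite coef0.
  by rewrite /deriv_value deriv0 !horner0 mul0r addr0.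
pose rel p := exists q, [/\ coef_graph p q, p.[y] = 0 & p != 0].
have [[p1 rp1]|norel] := pselect (exists p, rel p); last first.
  exists 0 => p q hp py; have [p0|p0] := eqVneq p 0.
    by rewrite p0 in hp *; apply: zero.
  by case: norel; exists p, q.
have [p [[q [hp py p0]] minp]] : exists p, rel p /\
    forall p', rel p' -> (size p <= size p')%N.
  have [k lek] := ubnP (size p1); elim: k => // k IH in p1 rp1 lek *.
  have [[p' [rp' lt]]|H] := pselect (exists p', rel p' /\ (size p' < size p1)%N).
    by apply: (IH p' rp'); apply: leq_trans lt _; rewrite -ltnS.
  exists p1; split=> // p' rp'; rewrite leqNgt; apply/negP => lt.
  by apply: H; exists p'.
(* By minimality the derivative of [p] is not a nonzero relation at [y], and it is not zero since
   [p] would then be a nonzero constant vanishing at [y]. So the equation for [u] can be solved. *)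
have p'y : p^`().[y] != 0.
  apply/negP => /eqP p'y; have [p'0|p'0] := eqVneq p^`() 0; last first.
    have /minp : rel p^`() by exists q^`(); split=> //; apply: coef_graph_deriv.
    by rewrite leqNgt (lt_size_deriv p0).
  have sp : (size p <= 1)%N.
    rewrite leqNgt; apply/negP => lt; have := congr1 (fun r : {poly K} => r`_(size p).-2) p'0.
    rewrite coef_deriv coef0 -mulr_natr => /eqP; rewrite mulf_eq0 (negPf (natr_ratfun_neq0 _ _)) orbF.
    by case E: (size p) lt => [|[|m]] //= _; rewrite -[m.+1]/(m.+2.-1) -E -lead_coefE lead_coef_eq0 (negPf p0).
  by move: p0 py; rewrite (size1_polyC sp) hornerC => p0 p00; rewrite p00 eqxx in p0.
exists (- q.[y] / p^`().[y]) => r s hr ry.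
have pv : deriv_value (- q.[y] / p^`().[y]) p q = 0.
  by rewrite /deriv_value mulrCA divff // mulr1 addrN.
set u := _ / _ in pv *.
have [k lek] := ubnP (size r); elim: k => // k IH in r s hr ry lek *.
have [r0|r0] := eqVneq r 0; first by rewrite r0 in hr *; apply: zero.
have le : (size p <= size r)%N by apply: minp; exists s.
pose m := 'X^(size r - size p) : {poly K}.
have hm := coef_graphXn (size r - size p); rewrite -/m in hm.
(* Pseudo-division: the leading terms cancel without dividing coefficients, since the domain of [G]
   is only a subring. *)
pose r2 := (lead_coef p)%:P * r - (lead_coef r)%:P * (m * p).
have [s2 [h2 v2]] : exists s2, coef_graph r2 s2 /\
    deriv_value u r2 s2 = lead_coef p * deriv_value u r s.
  have hlp : coef_graph (lead_coef p)%:P (q`_(size p).-1)%:P.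
    by apply: coef_graphC; apply: hp.
  have hlr : coef_graph (lead_coef r)%:P (s`_(size r).-1)%:P.
    by apply: coef_graphC; apply: hr.
  eexists; split; first exact: coef_graphB (coef_graphM hlp hr) (coef_graphM hlr (coef_graphM hm hp)).
  by rewrite deriv_valueB !deriv_valueM pv !hornerM ry py !hornerC; ring.
have lt : (size r2 < size r)%N.
  have r_gt0 : (0 < size r)%N by rewrite size_poly_gt0.
  rewrite -(prednK r_gt0) ltnS; apply/leq_sizeP => j lej.
  have sm : size (m * p) = size r by rewrite size_monicM ?monicXn // size_polyXn addSn /= subnK.
  rewrite coefB !coefCM; move: lej; rewrite leq_eqVlt => /orP [/eqP <-|lej].
    have -> : (m * p)`_(size r).-1 = lead_coef p.
      by rewrite -sm -lead_coefE lead_coef_monicM ?monicXn.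
    by rewrite -lead_coefE mulrC subrr.
  rewrite (prednK r_gt0) in lej.
  by rewrite !nth_default ?sm //; ring.
have r2y : r2.[y] = 0 by rewrite !(hornerD, hornerN, hornerM) ry py; ring.
have := IH _ _ h2 r2y (leq_trans lt lek); rewrite v2 => /eqP.
by rewrite mulf_eq0 lead_coef_eq0 (negPf p0) => /eqP.
Qed.

(** The elements p(y) form the new domain. The value is independent of p because two representations
    differ by a relation at [y], where [deriv_value_exists] gives zero. *)
Lemma deriv_graph_extend : exists G', [/\ deriv_graph G', G `<=` G' &
  exists u, G' (y, u)].
Proof.
have [u hu] := deriv_value_exists; have [Gc GD GM Gfun] := hG.
pose G' z := exists p q, coef_graph p q /\ z = (p.[y], deriv_value u p q).
have GG' : G `<=` G'.
  move=> [x a] Gxa; exists x%:P, a%:P; split; first exact: coef_graphC.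
  by rewrite /deriv_value derivC !hornerC mul0r addr0.
exists G'; split=> //; last first.
  exists u, 'X, 0; split; first exact: (coef_graphXn 1).
  by rewrite /deriv_value derivX horner0 hornerX hornerC mul1r add0r.
split.
- by move=> c; apply: GG'.
- move=> x a x' b [p [q [h [-> ->]]]] [p' [q' [h' [-> ->]]]].
  exists (p + p'), (q + q'); split; first exact: coef_graphD.
  by rewrite hornerD deriv_valueD.
- move=> x a x' b [p [q [h [-> ->]]]] [p' [q' [h' [-> ->]]]].
  exists (p * p'), (q * p' + p * q'); split; first exact: coef_graphM.
  by rewrite hornerM deriv_valueM.
move=> x a b [p [q [h [-> ->]]]] [p' [q' [h' [E ->]]]].
apply/eqP; rewrite -subr_eq0 -deriv_valueB; apply/eqP/hu.
  exact: coef_graphB.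
by rewrite hornerD hornerN E subrr.
Qed.

End Extend.

Lemma deriv_graph_total (G : set (K * K)) : deriv_graph G ->
  exists v : vfield X, forall x a, G (x, a) -> v x = a.
Proof.
move=> hG.
(* Joining [G] to each [A] makes the empty chain admissible in Zorn's lemma. *)
have [F sub tot|A [PA maxA]] := @Zorn_bigcup _ [set A | deriv_graph (A `|` G)].
  pose U := (\bigcup_(B in F) B) `|` G.
  (* Every clause of [deriv_graph] involves at most two elements of the graph, so it passes to the
     union from a single graph containing both. *)
  have two z z' : U z -> U z' -> exists B, [/\ deriv_graph B, B `<=` U, B z & B z'].
    have inF B : F B -> B `|` G `<=` U.
      by move=> FB x [Bx|]; [left; exists B|right].
    have cmp B B' : F B -> F B' -> exists C, [/\ F C, B `<=` C & B' `<=` C].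
      move=> FB FB'; have [BB'|B'B] := tot _ _ FB FB'; last by exists B; split=> // x.
      by exists B'; split=> // x.
    case=> [[B FB Bz]|Gz] [[B' FB' Bz']|Gz'].
    - have [C [FC BC B'C]] := cmp _ _ FB FB'.
      exists (C `|` G); split; [exact: sub|exact: inF|left; exact: BC|left; exact: B'C].
    - by exists (B `|` G); split; [exact: sub|exact: inF|left|right].
    - by exists (B' `|` G); split; [exact: sub|exact: inF|right|left].
    - by exists G; split=> // x; right.
  have [Gc _ _ _] := hG.
  split.
  - by move=> c; right.
  - by move=> x a y b h1 h2; have [B [[_ BD _ _] BU B1 B2]] := two _ _ h1 h2; apply/BU/BD.
  - by move=> x a y b h1 h2; have [B [[_ _ BM _] BU B1 B2]] := two _ _ h1 h2; apply/BU/BM.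
  - move=> x a b h1 h2; have [B [[_ _ _ Bf] BU B1 B2]] := two _ _ h1 h2; exact: Bf B1 B2.
have [Ac AD AM Af] := PA.
have tot y : exists a, (A `|` G) (y, a).
  have [G' [hG' AG' [u Gu]]] := deriv_graph_extend y PA.
  have GG' : G' `|` G = G'.
    by apply/seteqP; split=> [z [//|Gz]|z]; [apply: AG'; right|left].
  apply: contrapT => noy; apply: (maxA G'); last by rewrite /= GG'.
  split; first by move=> z Az; apply: AG'; left.
  by move=> G'A; apply: noy; exists u; left; apply: G'A.
have [v hv] := choice tot.
exists (@VField _ _ v (fun x y => Af _ _ _ (hv _) (AD _ _ _ _ (hv _) (hv _)))
  (fun x y => Af _ _ _ (hv _) (AM _ _ _ _ (hv _) (hv _)))
  (fun c => Af _ _ _ (hv _) (Ac c))).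
by move=> x a Gxa; apply: Af (hv x) _; right.
Qed.

(** Independence makes the i-th partial derivative well defined on the ring generated by [x], and
    [deriv_graph_total] extends it to [K]. *)
Lemma alg_indep_derivation n (x : 'I_n -> K) (i : 'I_n) :
  alg_independent x -> exists v : vfield X, forall j, v (x j) = (i == j)%:R.
Proof.
move=> ind.
pose G : set (K * K) := [set z | exists P, z = (keval x P, keval x (P^`M(i)))].
have [|v hv] := @deriv_graph_total G.
  split.
  - by move=> c; exists c%:MP; rewrite mderivC keval0 kevalC.
  - by move=> _ _ _ _ [P [-> ->]] [Q [-> ->]]; exists (P + Q); rewrite mderivD !kevalD.
  - move=> _ _ _ _ [P [-> ->]] [Q [-> ->]]; exists (P * Q).
    by rewrite mderivM kevalD !kevalM.
  move=> _ _ _ [P [-> ->]] [Q [E ->]]; congr (keval x (mderiv i _)).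
  apply/eqP; rewrite -subr_eq0; apply/eqP/ind.
  by have := kevalB x P Q; rewrite E subrr keval.unlock.
exists v => j; apply: hv; exists 'X_j.
by rewrite kevalX mderivXU; case: (i == j); rewrite ?mpolyC1 ?mpolyC0 ?keval1 ?keval0.
Qed.

End DerivationExtension.

(** * Values, regularity and the foliation of a form *)

Lemma meval_homog (C : comNzRingType) n d (P : {mpoly C[n]}) (c : C) (p : 'I_n -> C) :
  P \is d.-homog -> P.@[fun i => c * p i] = c ^+ d * P.@[p].
Proof.
move=> hP; rewrite !mevalE mulr_sumr; apply: eq_big_seq => m mP.
rewrite mulrCA; congr (_ * _).
have -> : d = mdeg m by apply/esym; apply: (dhomog_mf hP).
rewrite mdegE expr_sum -big_split /=; apply: eq_bigr => i _.
by rewrite exprMn.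
Qed.

Section Values.
Variables (R : realType) (X : proj_variety R).
Local Notation K := (ratfun X).
Local Open Scope classical_set_scope.
Implicit Types (p : hvec X) (f g : K) (U : zopen X).

Lemma has_value_const p c : has_value (rconst X c) p c.
Proof.
exists (hconst X c); split; rewrite //= ?meval1 ?mevalC ?divr1 //.
exact/eqP/oner_neq0.
Qed.

Lemma has_valueD p f g c d :
  has_value f p c -> has_value g p d -> has_value (f + g) p (c + d).
Proof.
move=> [a [-> /eqP a0 ->]] [b [-> /eqP b0 ->]]; exists (hadd a b); split.
- by rewrite -raddE.
- by rewrite /= mevalM; apply/eqP/mulf_neq0.
by rewrite /= mevalD !mevalM addf_div.
Qed.

Lemma has_valueM p f g c d :
  has_value f p c -> has_value g p d -> has_value (f * g) p (c * d).
Proof.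
move=> [a [-> /eqP a0 ->]] [b [-> /eqP b0 ->]]; exists (hmul a b); split.
- by rewrite -rmulE.
- by rewrite /= mevalM; apply/eqP/mulf_neq0.
by rewrite /= !mevalM mulf_div.
Qed.

Lemma has_value_inj p f c d :
  pts p -> has_value f p c -> has_value f p d -> c = d.
Proof.
move=> Xp [a [-> /eqP a0 ->]] [b [/rclassP/hequivP/(_ p Xp) E /eqP b0 ->]].
by apply/eqP; rewrite eqr_div // E.
Qed.

Lemma has_valueV p f c :
  pts p -> c != 0 -> has_value f p c -> has_value f^-1 p c^-1.
Proof.
move=> Xp c0 [a [Ef /eqP a0 Ec]].
have n0 : (hnum a).@[p] != 0.
  by apply: contraNneq c0 => n0; rewrite Ec n0 mul0r.
have nv : ~ vanishes (hnum a) by move=> /(_ p Xp) /eqP; rewrite (negPf n0).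
pose b := HFrac (hden_homog a) (hnum_homog a) nv.
have E : f * rclass b = 1.
  rewrite Ef -[_ * _]/(rmul _ _) rmulE.
  apply/(rclassP _ (hconst X 1))/hequivP => q _ /=.
  by rewrite !(mevalM, mevalC, meval1); ring.
have f0 : f != 0 by apply: contra_eq_neq E => ->; rewrite mul0r eq_sym oner_neq0.
exists b; split; last by rewrite Ec invf_div.
- by apply: (mulfI f0); rewrite E divff.
- exact/eqP.
Qed.

Lemma has_value_keval n (x : 'I_n -> K) p c (P : {mpoly R[i][n]}) :
  (forall i, has_value (x i) p (c i)) -> has_value (keval x P) p P.@[c].
Proof.
move=> hx; elim/mpoly_ind_ring: P => [a|i|P Q hP hQ|P Q hP hQ].
- by rewrite kevalC mevalC; apply: has_value_const.
- by rewrite kevalX mevalXU.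
- by rewrite kevalD mevalD; apply: has_valueD.
- by rewrite kevalM mevalM; apply: has_valueM.
Qed.

Lemma regular_at_const p c : regular_at p (rconst X c).
Proof. by exists c; apply: has_value_const. Qed.

Lemma regular_atD p f g : regular_at p f -> regular_at p g -> regular_at p (f + g).
Proof. by move=> [c hc] [d hd]; exists (c + d); apply: has_valueD. Qed.

Lemma regular_atM p f g : regular_at p f -> regular_at p g -> regular_at p (f * g).
Proof. by move=> [c hc] [d hd]; exists (c * d); apply: has_valueM. Qed.

Lemma regular_atB p f g : regular_at p f -> regular_at p g -> regular_at p (f - g).
Proof.
move=> hf hg; apply: regular_atD => //; rewrite -mulN1r -(rmorphN1 (rconst X)).
exact: regular_atM (regular_at_const _ _) hg.
Qed.

Lemma regular_at_sum p n (F : 'I_n -> K) :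
  (forall i, regular_at p (F i)) -> regular_at p (\sum_i F i).
Proof.
move=> hF; elim/big_ind: _ => [|f g|i _] //; last exact: regular_atD.
by rewrite -(rmorph0 (rconst X)); apply: regular_at_const.
Qed.

Lemma zset_pts U p : zset U p -> pts p.
Proof. by have [E _ ->] := zset_open U; case. Qed.

Lemma basic_zopen (P : hpoly X) p : homogeneous P -> pts p -> P.@[p] != 0 ->
  exists U, zset U = [set q | pts q /\ P.@[q] <> 0].
Proof.
move=> hP Xp P0; pose S := [set q | pts q /\ P.@[q] <> 0].
have ne : S !=set0 by exists p; split=> //; apply/eqP.
have op : exists2 E : set (hpoly X), (forall Q, E Q -> homogeneous Q) &
    S = [set q | pts q /\ exists2 Q, E Q & Q.@[q] <> 0].
  exists [set P]; first by move=> Q ->.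
  apply/seteqP; split=> q /= [Xq]; first by move=> Pq; split=> //; exists P.
  by case=> Q -> Qq.
by exists (ZOpen ne op).
Qed.

Lemma zopen_meet U V p : zset U p -> zset V p ->
  exists W, [/\ zset W `<=` zset U, zset W `<=` zset V & zset W p].
Proof.
have [E hE EU] := zset_open U; have [E' hE' EV] := zset_open V.
rewrite EU EV => -[Xp [P EP Pp]] [_ [Q EQ Qp]].
have [[d hP] [e hQ]] := (hE _ EP, hE' _ EQ).
have PQ0 : (P * Q).@[p] != 0 by rewrite mevalM mulf_neq0 //; apply/eqP.
have [|W EW] := @basic_zopen (P * Q) p _ Xp PQ0.
  by exists (d + e)%N; apply: dhomogM.
exists W; rewrite EW; split=> [q [Xq /eqP]|q [Xq /eqP]|].
- rewrite mevalM mulf_eq0 negb_or => /andP [/eqP Pq _].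
  by split=> //; exists P.
- rewrite mevalM mulf_eq0 negb_or => /andP [_ /eqP Qq].
  by split=> //; exists Q.
by split=> //; apply/eqP.
Qed.

Lemma zopen_avoid U (P : hpoly X) : homogeneous P -> ~ vanishes P ->
  exists2 W, zset W `<=` zset U & forall p, zset W p -> P.@[p] <> 0.
Proof.
move=> hP nP; have [E hE EU] := zset_open U; have [p Up] := zset_neq0 U.
move: Up; rewrite EU => -[Xp [Q EQ Qp]].
have [q [Xq QPq]] : exists q, pts q /\ (Q * P).@[q] != 0.
  apply: contrapT => H; have [] := @vanishesM _ X Q P (hE _ EQ) hP.
  - move=> q Xq; apply/eqP/negP => /negP QPq; apply: H; by exists q.
  - by move/(_ p Xp).
  - exact: nP.
have [[d hQ] [e hP']] := (hE _ EQ, hP).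
have [|W EW] := @basic_zopen (Q * P) q _ Xq QPq.
  by exists (d + e)%N; apply: dhomogM.
exists W; rewrite EW => r [Xr /eqP]; rewrite mevalM mulf_eq0 negb_or => /andP [/eqP Qr /eqP Pr] //.
by split=> //; exists Q.
Qed.

Lemma regular_shrink U f :
  exists2 W, zset W `<=` zset U & regular_fun W f.
Proof.
elim/rind: f => a.
have [|W WU hW] := @zopen_avoid U (hden a) _ (@hden_neq0 _ _ a).
  by exists (hdeg a); apply: hden_homog.
exists W => // p Wp; exists ((hnum a).@[p] / (hden a).@[p]), a; split=> //.
exact: hW.
Qed.

Lemma regular_shrink_seq U (s : seq K) :
  exists2 W, zset W `<=` zset U & forall f, f \in s -> regular_fun W f.
Proof.
elim: s => [|f s [W WU hW]]; first by exists U.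
have [W' W'W hf] := regular_shrink W f; exists W' => [p /W'W/WU //|g].
rewrite inE => /orP [/eqP -> //|gs] p Wp.
by apply: (hW g gs); apply: W'W.
Qed.

Lemma regular_shrink_fam U n (F : 'I_n -> K) :
  exists2 W, zset W `<=` zset U & forall i, regular_fun W (F i).
Proof.
have [W WU hW] := regular_shrink_seq U [seq F i | i <- enum 'I_n].
by exists W => // i; apply: hW; apply: map_f; rewrite mem_enum.
Qed.

Lemma whole_zopen : exists U, zset U = @pts R X.
Proof.
have [p Xp] := pnonempty X.
have [||U EU] := @basic_zopen 1 p _ Xp.
- by exists 0%N; apply: dhomog1.
- by rewrite meval1 oner_neq0.
exists U; rewrite EU; apply/seteqP; split=> q /=; first by case.
by move=> Xq; split=> //; rewrite meval1; apply/eqP/oner_neq0.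
Qed.

Lemma nonzero_shrink U f : f != 0 ->
  exists2 W, zset W `<=` zset U &
    forall p, zset W p -> exists2 c, has_value f p c & c != 0.
Proof.
move=> f0; have [V VU hf] := regular_shrink U f.
have [W WV hg] := regular_shrink V f^-1.
exists W => [p /WV/VU //|p Wp].
have [c hc] := hf p (WV p Wp); have [d hd] := hg p Wp; exists c => //.
have := has_valueM hc hd; rewrite divff // -(rmorph1 (rconst X)) => h1.
have := has_value_inj (zset_pts Wp) h1 (has_value_const p 1).
by move=> E; apply: contra_eq_neq E => ->; rewrite mul0r eq_sym oner_neq0.
Qed.

(** Used to turn identities between values into identities of rational functions: a nonzero
    difference would show at such a point. *)
Lemma generic_point n (F : 'I_n -> K) g : g != 0 ->
  exists p c d, [/\ pts p, forall i, has_value (F i) p (c i), has_value g p d & d != 0].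
Proof.
move=> g0; have [U _] := whole_zopen.
have [V _ hV] := regular_shrink_fam U F; have [W WV hW] := nonzero_shrink V g0.
have [p Wp] := zset_neq0 W; have [d hd d0] := hW p Wp.
have /choice [c hc] : forall i, exists c, has_value (F i) p c.
  by move=> i; apply: hV; apply: WV.
by exists p, c, d; split=> //; apply: zset_pts Wp.
Qed.

End Values.

(** * Affine charts and regularity of vector fields *)

Section Charts.
Variables (R : realType) (X : proj_variety R).
Local Notation K := (ratfun X).
Local Open Scope classical_set_scope.
Implicit Types (p : hvec X) (f g : K) (U : zopen X).

Lemma homogXU (i : 'I_(pamb X).+1) : ('X_i : hpoly X) \is 1.-homog.
Proof. by rewrite dhomogX; apply/eqP; exact: mdeg1. Qed.

Lemma homogeneousX (i : 'I_(pamb X).+1) : homogeneous ('X_i : hpoly X).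
Proof. by exists 1%N; apply: homogXU. Qed.

Lemma homogeneous_hden (a : hfrac X) : homogeneous (hden a).
Proof. by exists (hdeg a); apply: hden_homog. Qed.

Lemma homogeneous_hnum (a : hfrac X) : homogeneous (hnum a).
Proof. by exists (hdeg a); apply: hnum_homog. Qed.

Lemma coordinate_neq0 : exists i, ~ vanishes ('X_i : hpoly X).
Proof.
have [p Xp] := pnonempty X; have [[i pi] _] := Xp.
by exists i => /(_ p Xp); rewrite mevalXU.
Qed.

Section Chart.
Variable i0 : 'I_(pamb X).+1.
Hypothesis i0P : ~ vanishes ('X_i0 : hpoly X).

Definition chart (i : 'I_(pamb X).+1) : K := rclass (HFrac (homogXU i) (homogXU i0) i0P).

Lemma has_value_chart p i : p i0 != 0 -> has_value (chart i) p ((p i0)^-1 * p i).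
Proof.
by move=> p0; eexists; split; first reflexivity; rewrite /= !mevalXU; [exact/eqP|rewrite mulrC].
Qed.

Lemma has_value_keval_chart d (P : hpoly X) p : P \is d.-homog -> p i0 != 0 ->
  has_value (keval chart P) p ((p i0) ^- d * P.@[p]).
Proof.
move=> hP p0; rewrite -exprVn -(meval_homog _ _ hP).
by apply: has_value_keval => i; apply: has_value_chart.
Qed.

(** Evaluating a homogeneous polynomial on the chart divides it by a power of the coordinate [i0].
    Numerator and denominator have the same degree, so these powers cancel. *)
Lemma chart_frac (a : hfrac X) :
  rclass a * keval chart (hden a) = keval chart (hnum a).
Proof.
apply/eqP; rewrite -subr_eq0; apply/negP => /negP g0.
have [U EU] := whole_zopen X.
have [V VU hV] := zopen_avoid U (homogeneousX i0) i0P.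
have [W WV hW] := zopen_avoid V (homogeneous_hden a) (@hden_neq0 _ _ a).
have [T TW hT] := nonzero_shrink W g0.
have [p Tp] := zset_neq0 T.
have [c hc c0] := hT p Tp.
have p0 : p i0 != 0 by apply/eqP; have := hV p (WV _ (TW _ Tp)); rewrite mevalXU.
have da := hW p (TW _ Tp).
case/eqP: c0; apply: has_value_inj (zset_pts Tp) hc _.
have ha : has_value (rclass a) p ((hnum a).@[p] / (hden a).@[p]) by exists a.
have h1 := has_valueM ha (has_value_keval_chart (hden_homog a) p0).
have h2 := has_valueM (has_value_const p (-1)) (has_value_keval_chart (hnum_homog a) p0).
have := has_valueD h1 h2; rewrite rmorphN1 mulN1r; congr (has_value _ _ _).
by rewrite mulrCA divfK ?mulN1r ?addrN //; apply/eqP.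
Qed.

Lemma regular_at_keval n (x : 'I_n -> K) p (P : {mpoly R[i][n]}) :
  (forall i, regular_at p (x i)) -> regular_at p (keval x P).
Proof.
by move=> /choice [c hc]; exists P.@[c]; apply: has_value_keval.
Qed.

(** Near [p], [f] is a quotient of polynomials in the chart functions, so the Leibniz rule reduces
    regularity to finitely many functions and one shrinking suffices in [vfield_shrink]. *)
Lemma vapp_regular (v : vfield X) p f : pts p -> p i0 != 0 ->
  (forall i, regular_at p (v (chart i))) -> regular_at p f -> regular_at p (v f).
Proof.
move=> Xp p0 hv [_ [a [-> /eqP da _]]].
have ry i : regular_at p (chart i) by eexists; apply: has_value_chart.
have hd := has_value_keval_chart (hden_homog a) p0.
have d0 : p i0 ^- hdeg a * (hden a).@[p] != 0.
  by rewrite mulf_neq0 // invr_eq0 expf_neq0.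
have D0 : keval chart (hden a) != 0.
  apply: contra_neq d0 => E; rewrite E -(rmorph0 (rconst X)) in hd.
  exact: has_value_inj Xp hd (has_value_const _ _).
have -> : rclass a = keval chart (hnum a) / keval chart (hden a).
  by rewrite -chart_frac mulfK.
have rv P : regular_at p (v (keval chart P)).
  rewrite vapp_keval; apply: regular_at_sum => i.
  by apply: regular_atM (hv i); apply: regular_at_keval.
have rk P : regular_at p (keval chart P) by apply: regular_at_keval.
rewrite vapp_div // invfM; apply: regular_atM.
  by apply: regular_atB; apply: regular_atM.
by apply: regular_atM; eexists; apply: has_valueV hd.
Qed.

End Chart.

Lemma vfield_shrink U (v : vfield X) :
  exists2 W, zset W `<=` zset U & regular_vfield W v.
Proof.
have [i0 i0P] := coordinate_neq0.
have [V VU hV] := zopen_avoid U (homogeneousX i0) i0P.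
have [W WV hW] := regular_shrink_fam V (fun i => v (chart i0P i)).
exists W => [p /WV/VU //|p Wp f]; apply: (vapp_regular (i0P := i0P) (zset_pts Wp)).
  by apply/eqP; have := hV p (WV p Wp); rewrite mevalXU.
by move=> i; apply: hW.
Qed.

End Charts.

(** * The foliation defined by an integrable form *)

Section FoliationOfForm.
Variables (R : realType) (X : proj_variety R).
Local Notation K := (ratfun X).
Local Open Scope classical_set_scope.
Implicit Types (U V W : zopen X) (a : rform X) (v : vfield X).

(** An [rform] is an abstract functional; a presentation by differentials is what yields regularity
    on some open set. *)
Definition kahler (b : rform X) :=
  exists m (g h : 'I_m -> K), b = \sum_i g i *: dfun (h i).

Lemma kahler_shrink U b : kahler b -> exists2 W, zset W `<=` zset U & regular_form W b.
Proof.
move=> [m [g [h ->]]].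
have [V VU hg] := regular_shrink_fam U g; have [W WV hh] := regular_shrink_fam V h.
exists W => [p /WV/VU //|p Wp]; exists m, g, h; split=> // i.
by split; [apply: hg; apply: WV|apply: hh].
Qed.

Lemma regular_form_sub : subsheaf (@regular_form R X) (@regular_form R X).
Proof.
split; first by move=> U x.
- move=> U; split=> [p Up|f x y hf hx hy p Up].
    exists 0%N, (fun=> 0), (fun=> 0); split; first by case.
    by rewrite big_ord0.
  have [m [g [h [hgh ->]]]] := hx p Up; have [m' [g' [h' [hgh' ->]]]] := hy p Up.
  exists (m + m')%N,
    (fun i => match split i with inl j => f * g j | inr j => g' j end),
    (fun i => match split i with inl j => h j | inr j => h' j end).
  split=> [i|].
    case: (split i) => j; last exact: hgh'.
    have [h1 h2] := hgh j; split=> //; apply: regular_atM h1; exact: hf.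
  rewrite big_split_ord /= scaler_sumr; congr (_ + _); apply: eq_bigr => j _.
    by rewrite -[lshift _ _]/(unsplit (inl j)) unsplitK scalerA.
  by rewrite -[rshift _ _]/(unsplit (inr j)) unsplitK.
- by move=> U U' U'U x hx p /U'U; apply: hx.
move=> U I W x EU hx p; rewrite -[_ p]/((U : set _) p) EU => -[i _ Wp].
exact: hx Wp.
Qed.

Lemma regular_vfield_sub : subsheaf (@regular_vfield R X) (@regular_vfield R X).
Proof.
split; first by move=> U x.
- move=> U; split=> [p Up f _|f x y hf hx hy p Up g hg].
    by rewrite vzeroE -(rmorph0 (rconst X)); apply: regular_at_const.
  rewrite vaddE vscaleE; apply: regular_atD; last exact: hy.
  by apply: regular_atM; [exact: hf|exact: hx].
- by move=> U U' U'U x hx p /U'U; apply: hx.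
move=> U I W x EU hx p; rewrite -[_ p]/((U : set _) p) EU => -[i _ Wp].
exact: hx Wp.
Qed.

Variable b : rform X.
Hypotheses (b0 : b <> 0) (ib : integrable b) (kb : kahler b).

Let T U := [set v | regular_vfield U v /\ b v = 0].
Let N U := [set a | regular_form U a /\
  forall U' v, zset U' `<=` zset U -> T U' v -> a v = 0].

Lemma transversal_vfield : exists v, b v = 1.
Proof.
have [v bv] : exists v, b v != 0.
  apply: contrapT => H; apply: b0; apply: form_ext => v.
  by rewrite fzeroE; apply/eqP/negP => /negP bv; apply: H; exists v.
by exists ((b v)^-1 *: v); rewrite fappZ mulVf.
Qed.

Lemma T_sub : subsheaf (@regular_vfield R X) T.
Proof.
have [_ h1 h2 h3] := regular_vfield_sub; split.
- by move=> U v [].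
- move=> U; split; first by split; [case: (h1 U)|rewrite fapp0].
  move=> f x y hf [rx bx] [ry by_]; split; first by case: (h1 U) => _; apply.
  by rewrite fappD fappZ bx by_ mulr0 addr0.
- by move=> U U' U'U v [rv bv]; split=> //; apply: h2 rv.
move=> U I W v EU hv; split; first by apply: (h3 _ _ _ _ EU) => i; case: (hv i).
have [p] := zset_neq0 U; rewrite -[_ p]/((U : set _) p) EU => -[i _ _].
by case: (hv i).
Qed.

Lemma N_sub : subsheaf (@regular_form R X) N.
Proof.
have [_ h1 h2 h3] := regular_form_sub; split.
- by move=> U v [].
- move=> U; split; first by split; [case: (h1 U)|move=> U' v _ _; rewrite fzeroE].
  move=> f x y hf [rx bx] [ry by_]; split; first by case: (h1 U) => _; apply.
  move=> U' v U'U Tv; rewrite faddE fscaleE (bx _ _ U'U Tv) (by_ _ _ U'U Tv).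
  by rewrite mulr0 addr0.
- move=> U U' U'U a [ra ha]; split; first exact: h2 ra.
  by move=> V v VU'; apply: ha => p /VU'/U'U.
move=> U I W a EU ha; split; first by apply: (h3 _ _ _ _ EU) => i; case: (ha i).
move=> V v VU Tv; have [p Vp] := zset_neq0 V.
have := VU p Vp; rewrite -[_ p]/((U : set _) p) EU => -[i _ Wp].
have [V' [V'V V'W _]] := zopen_meet Vp Wp.
have [_ _ Tr _] := T_sub.
by have [_] := ha i; apply; [exact: V'W|apply: Tr Tv].
Qed.

(** [T] is the kernel of [b] and [N] its annihilator. Conversely [N] determines [T], because [b]
    itself lies in [N] after shrinking. *)
Lemma form_foliation : exists F : foliation X, defines b F.
Proof.
have Tann U v : T U v <-> regular_vfield U v /\
    forall U' a, zset U' `<=` zset U -> N U' a -> a v = 0.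
  have [_ _ Tr _] := T_sub; split=> [Tv|[rv hv]].
    split; first by case: Tv.
    by move=> U' a U'U [_ ha]; apply: (ha U') => //; apply: (Tr U).
  split=> //; have [W WU rb] := kahler_shrink U kb.
  by apply: (hv W) => //; split=> // U' w _ [].
have br U v w : T U v -> T U w -> T U (bracket v w).
  move=> [rv bv] [rw bw]; split.
    move=> p Up f hf; apply: regular_atB.
      by apply: rv => //; apply: rw.
    by apply: rw => //; apply: rv.
  (* With b(u) = 1 and b(v) = b(w) = 0, integrability on (u, v, w) reads db(v, w) = 0, hence
     b([v, w]) = 0. *)
  have [u bu] := transversal_vfield; have := ib u v w.
  rewrite /wedge12 bu bv bw !mul0r mul1r !addr0 /dform bv bw !vapp0 subrr sub0r.
  by move/eqP; rewrite oppr_eq0 => /eqP.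
pose F := Foliation T_sub N_sub Tann (fun U a => iff_refl _) br.
exists F; split=> //.
have [V0 _] := whole_zopen X.
exists (fun=> b); split.
- move=> _; have [W _ rb] := kahler_shrink V0 kb.
  by exists W; split=> // U' w _ [].
- move=> c; rewrite big_ord1 => E i; rewrite ord1.
  have [u bu] := transversal_vfield.
  by have := congr1 (fun a : rform X => a u) E; rewrite fscaleE bu mulr1.
move=> U a [ra ha]; have [u bu] := transversal_vfield.
(* The field v - b(v) u is in the kernel of [b] and regular after shrinking, so [a] kills it and a =
   a(u) b. *)
exists (fun=> a u); rewrite big_ord1; apply: form_ext => v; rewrite fscaleE.
have [W WU rv] := vfield_shrink U (v - b v *: u).
have : a (v - b v *: u) = 0.
  by apply: (ha W) => //; split=> //; rewrite fappB fappZ bu mulr1 subrr.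
by rewrite fappB fappZ => /eqP; rewrite subr_eq0 mulrC => /eqP.
Qed.

End FoliationOfForm.

(** * The closure of the image of a rational map *)

Section Image.
Variables (R : realType) (X : proj_variety R) (n : nat).
Local Notation K := (ratfun X).
Local Open Scope classical_set_scope.
Variable f : 'I_n.+1 -> K.
Hypothesis f0 : f ord0 = 1.

(** The homogeneous relations between the coordinates [f]: the ideal of the closure of the image. It
    is prime because [K] is a field, whence [image_irreducible]. *)
Definition image_eqs : set {mpoly R[i][n.+1]} :=
  [set P | homogeneous P /\ keval f P = 0].

Lemma image_eqs_homog P : image_eqs P -> homogeneous P.
Proof. by case. Qed.

Lemma image_value p c : pts p -> (forall i, has_value (f i) p (c i)) ->
  proj_zeros image_eqs c.
Proof.
move=> Xp hc; split.
  exists ord0; have := hc ord0; rewrite f0 -(rmorph1 (rconst X)) => h.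
  by rewrite (has_value_inj Xp h (has_value_const _ _)); apply/eqP/oner_neq0.
move=> P [_ P0]; have := has_value_keval P hc.
rewrite P0 -(rmorph0 (rconst X)) => h.
exact: has_value_inj Xp h (has_value_const _ _).
Qed.

Lemma keval_eq0_of_values P :
  (forall p c, pts p -> (forall i, has_value (f i) p (c i)) -> P.@[c] = 0) ->
  keval f P = 0.
Proof.
move=> H; apply/eqP/negP => /negP P0.
have [p [c [d [Xp hc hd d0]]]] := generic_point f P0.
case/eqP: d0; rewrite -(H p c Xp hc).
exact: has_value_inj Xp hd (has_value_keval P hc).
Qed.

Lemma keval_eq0_of_zeros P :
  (forall q, proj_zeros image_eqs q -> P.@[q] = 0) -> keval f P = 0.
Proof. by move=> H; apply: keval_eq0_of_values => p c Xp /(image_value Xp); apply: H. Qed.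

Lemma image_nonempty : proj_zeros image_eqs !=set0.
Proof.
apply: contrapT => H; have : keval f 1 = 0.
  by apply: keval_eq0_of_zeros => q hq; case: H; exists q.
by rewrite keval1 => /eqP; rewrite oner_eq0.
Qed.

Lemma image_irreducible P Q : homogeneous P -> homogeneous Q ->
  (forall q, proj_zeros image_eqs q -> (P * Q).@[q] = 0) ->
  (forall q, proj_zeros image_eqs q -> P.@[q] = 0) \/
  (forall q, proj_zeros image_eqs q -> Q.@[q] = 0).
Proof.
move=> hP hQ /keval_eq0_of_zeros /eqP; rewrite kevalM mulf_eq0.
by case/orP => /eqP E; [left|right] => q [_]; apply.
Qed.

Definition image_variety : proj_variety R :=
  ProjVariety image_eqs_homog image_nonempty image_irreducible.

Lemma map_mpoly_homog d (P : {mpoly R[i][n.+1]}) :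
  P \is d.-homog -> map_mpoly (rconst X) P \is d.-homog.
Proof.
move=> /dhomogP hP; apply/dhomogP => m; rewrite mcoeff_msupp mcoeff_map_mpoly.
by rewrite fmorph_eq0 -mcoeff_msupp; apply: hP.
Qed.

Lemma image_sends p q : @sends R X image_variety f p q -> pts (X := image_variety) q.
Proof.
case=> Xp q0 [g hg]; split=> // P [[d hP] P0].
have := has_value_keval P hg.
rewrite keval.unlock (meval_homog _ _ (map_mpoly_homog hP)).
move: P0; rewrite keval.unlock => ->; rewrite mulr0 -(rmorph0 (rconst X)) => h.
exact: has_value_inj Xp h (has_value_const _ _).
Qed.

Lemma image_coord_neq0 : exists i, f i <> 0.
Proof. by exists ord0; rewrite f0; apply/eqP/oner_neq0. Qed.

Definition image_map : ratmap X image_variety :=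
  @RatMap R X image_variety f image_coord_neq0 image_sends.

Lemma image_map_dominant : dominant image_map.
Proof.
move=> P hP H q [_]; apply; split=> //; apply: keval_eq0_of_values => p c Xp hc.
apply: (H p c); split=> //; first by have [] := image_value Xp hc.
by exists 1 => i; rewrite mul1r.
Qed.

Local Notation L := (ratfun image_variety).

Lemma keval_hden (a : hfrac image_variety) : keval f (hden a) != 0.
Proof.
apply/eqP => H; apply: (@hden_neq0 _ _ a) => q [_]; apply.
by split=> //; exact: (homogeneous_hden a).
Qed.

(** The embedding of function fields given by pullback. [pull_class] shows that the representative
    is immaterial. *)
Definition pull (x : L) : K := keval f (hnum (repr x)) / keval f (hden (repr x)).

Lemma pull_class a : pull (rclass a) = keval f (hnum a) / keval f (hden a).
Proof.
apply/eqP; rewrite eqr_div ?keval_hden // -!kevalM -subr_eq0 -kevalB.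
apply/eqP/keval_eq0_of_zeros => q Yq; rewrite mevalB !mevalM.
by have /hequivP/(_ q Yq) -> := hrepr a; rewrite subrr.
Qed.

Lemma heval_image P : heval image_map P = keval f P.
Proof. by rewrite keval.unlock. Qed.

Lemma pullback_pull x : pullback_fun image_map x (pull x).
Proof.
exists (repr x); rewrite !heval_image rclass_repr; split=> //.
by apply/eqP; exact: (keval_hden (repr x)).
Qed.

Lemma pullC c : pull (rconst image_variety c) = rconst X c.
Proof. by rewrite pull_class /= keval1 divr1 kevalC. Qed.

Lemma pullD x y : pull (x + y) = pull x + pull y.
Proof.
elim/rind: x => a; elim/rind: y => b; rewrite -[_ + _]/(radd _ _) raddE !pull_class /=.
by rewrite kevalD !kevalM addf_div ?keval_hden.
Qed.

Lemma pullM x y : pull (x * y) = pull x * pull y.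
Proof.
elim/rind: x => a; elim/rind: y => b; rewrite -[_ * _]/(rmul _ _) rmulE !pull_class /=.
by rewrite !kevalM mulf_div.
Qed.

Lemma pullN x : pull (- x) = - pull x.
Proof. by rewrite -mulN1r -(rmorphN1 (rconst image_variety)) pullM pullC rmorphN1 mulN1r. Qed.

Lemma pullB x y : pull (x - y) = pull x - pull y.
Proof. by rewrite pullD pullN. Qed.

Lemma pull_eq0 x : pull x = 0 -> x = 0.
Proof.
elim/rind: x => a; rewrite pull_class => /eqP.
rewrite mulf_eq0 invr_eq0 (negPf (keval_hden a)) orbF => /eqP H.
apply/rclass_eq0 => q [_]; apply; split=> //; exact: (homogeneous_hnum a).
Qed.

Lemma pull_keval m (x : 'I_m -> L) P : pull (keval x P) = keval (fun i => pull (x i)) P.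
Proof.
elim/mpoly_ind_ring: P => [c|i|P Q hP hQ|P Q hP hQ].
- by rewrite !kevalC pullC.
- by rewrite !kevalX.
- by rewrite !kevalD pullD hP hQ.
- by rewrite !kevalM pullM hP hQ.
Qed.

Lemma alg_independent_pull m (x : 'I_m -> L) :
  alg_independent x <-> alg_independent (fun i => pull (x i)).
Proof.
rewrite !alg_independentE; split=> H P; rewrite -?pull_keval => HP; apply: H.
  exact: pull_eq0.
by rewrite -pull_keval HP -(rmorph0 (rconst image_variety)) pullC rmorph0.
Qed.

Lemma image_coord0 : ~ vanishes ('X_ord0 : hpoly image_variety).
Proof.
move/keval_eq0_of_zeros => /eqP; rewrite kevalX f0.
by rewrite oner_eq0.
Qed.

Definition image_coord (i : 'I_n.+1) : L := chart image_coord0 i.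

Lemma pull_coord i : pull (image_coord i) = f i.
Proof. by rewrite pull_class /= !kevalX f0 divr1. Qed.

End Image.

(** * Forms on surfaces *)

Section Defining.
Variables (R : realType) (X : proj_variety R).
Local Notation K := (ratfun X).

Lemma definesZ (l : K) (w : rform X) F : l != 0 -> defines w F -> defines (l *: w) F.
Proof.
move=> l0 [w0 iw cF TF]; split=> //; last first.
- move=> U v; rewrite TF fscaleE; split=> -[rv] => [->|/eqP]; first by rewrite mulr0.
  by rewrite mulf_eq0 (negPf l0) => /eqP.
- exact: integrableZ.
move=> E; apply: w0; rewrite -[w]scale1r -(mulVf l0) -scalerA E.
exact: scaler0.
Qed.

(** A square matrix with a nonzero kernel vector has determinant zero: by the adjugate, each c_i
    times the determinant is a combination of the three relations. *)
Lemma dependent_det (a0 a1 a2 b0 b1 b2 e0 e1 e2 c0 c1 c2 : K) :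
  c0 * a0 + c1 * a1 + c2 * a2 = 0 -> c0 * b0 + c1 * b1 + c2 * b2 = 0 ->
  c0 * e0 + c1 * e1 + c2 * e2 = 0 -> [|| c0 != 0, c1 != 0 | c2 != 0] ->
  a0 * (b1 * e2 - b2 * e1) + a1 * (b2 * e0 - b0 * e2) + a2 * (b0 * e1 - b1 * e0) = 0.
Proof.
set D := (X in _ -> _ -> _ -> _ -> X = 0).
set za := (X in X = 0 -> _); set zb := (X in _ -> X = 0 -> _).
set ze := (X in _ -> _ -> X = 0 -> _) => ha hb he.
have H0 : c0 * D = za * (b1 * e2 - b2 * e1) + zb * (a2 * e1 - a1 * e2) + ze * (a1 * b2 - a2 * b1).
  by rewrite /D /za /zb /ze; ring.
have H1 : c1 * D = za * (b2 * e0 - b0 * e2) + zb * (a0 * e2 - a2 * e0) + ze * (a2 * b0 - a0 * b2).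
  by rewrite /D /za /zb /ze; ring.
have H2 : c2 * D = za * (b0 * e1 - b1 * e0) + zb * (a1 * e0 - a0 * e1) + ze * (a0 * b1 - a1 * b0).
  by rewrite /D /za /zb /ze; ring.
rewrite ha hb he !mul0r !addr0 in H0 H1 H2.
by case/or3P => c; apply: (mulfI c); rewrite mulr0.
Qed.

Hypothesis dim2 : forall x : 'I_3 -> K, ~ alg_independent x.

(** The form wedged with its differential is P dg /\ dQ /\ dh + Q dh /\ dP /\ dg, and dx /\ dy /\ dz
    = 0 for any three functions on a surface, which is [dep]. *)
Lemma surface_integrable (P Q g h : K) : integrable (P *: dfun g + Q *: dfun h).
Proof.
have dep (x y z : K) (u v w : vfield X) :
    u x * (v y * w z - v z * w y) + u y * (v z * w x - v x * w z)
    + u z * (v x * w y - v y * w x) = 0 :> K.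
  have [c [i ci] hc] := alg_dep_dfun (@dim2 (fun i : 'I_3 => [:: x; y; z]`_i)).
  have E (t : vfield X) : c (inord 0) * t x + c (inord 1) * t y + c (inord 2) * t z = 0.
    rewrite -[RHS](hc t) !big_ord_recr big_ord0 /= add0r.
    by congr (_ * _ + _ * _ + _ * _); congr c; apply/val_inj; rewrite /= inordK.
  apply: (dependent_det (E u) (E v) (E w)).
  move: ci; have -> : i = inord i by apply/val_inj; rewrite /= inordK.
  by case: i => [[|[|[|//]]]] /= _ ->; rewrite ?orbT.
move=> u v w.
rewrite /wedge12 !dformD !dformZ !dform_dfun !faddE !fscaleE !dfunE.
have := congr2 (fun a b => a + b) (congr1 (fun x => P * x) (dep g Q h u v w))
          (congr1 (fun x => Q * x) (dep h P g u v w)).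
by rewrite !mulr0 addr0 => E; rewrite -[RHS]E; ring.
Qed.

End Defining.

(** * Pencils of integrable forms *)

Section Frame.
Variables (R : realType) (X : proj_variety R) (w0 w1 : rform X).
Local Notation K := (ratfun X).

Lemma dual_frame : (exists v w, wedge11 w0 w1 v w <> 0) ->
  exists v0 v1, [/\ w0 v0 = 1, w0 v1 = 0, w1 v0 = 0 & w1 v1 = 1].
Proof.
case=> v [w]; rewrite /wedge11 => /eqP; set D := (X in X != 0) => D0.
exists (D^-1 *: (w1 w *: v - w1 v *: w)), (D^-1 *: (w0 v *: w - w0 w *: v)).
rewrite !(fappZ, fappB).
split.
- by rewrite -[RHS](mulVf D0) /D; congr (_ * _); ring.
- by rewrite [X in _ * X](_ : _ = 0) ?mulr0 //; ring.
- by rewrite [X in _ * X](_ : _ = 0) ?mulr0 //; ring.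
- by rewrite -[RHS](mulVf D0) /D; congr (_ * _); ring.
Qed.

(** Contracting with [v0] and [v1] gives dw0 = a0 /\ w0 and dw1 = a1 /\ w1. Polarising, w0 /\ dw1 +
    w1 /\ dw0 = 0, so a0 - a1 is a combination of w0 and w1 ([E2]); moving its w0 part to a0 makes
    one form serve both. *)
Lemma common_connection v0 v1 :
  w0 v0 = 1 -> w0 v1 = 0 -> w1 v0 = 0 -> w1 v1 = 1 ->
  integrable w0 -> integrable w1 -> integrable (w0 + w1) ->
  exists th : rform X,
    (forall x y, dform w0 x y = th x * w0 y - th y * w0 x) /\
    (forall x y, dform w1 x y = th x * w1 y - th y * w1 x).
Proof.
move=> e00 e01 e10 e11 i0 i1 i2.
have E0 x y : dform w0 x y = dform w0 x v0 * w0 y - dform w0 y v0 * w0 x.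
  have := i0 v0 x y; rewrite /wedge12 e00 [dform w0 v0 x]dformC => /eqP.
  by rewrite mul1r -addrA addr_eq0 => /eqP ->; ring.
have E1 x y : dform w1 x y = dform w1 x v1 * w1 y - dform w1 y v1 * w1 x.
  have := i1 v1 x y; rewrite /wedge12 e11 [dform w1 v1 x]dformC => /eqP.
  by rewrite mul1r -addrA addr_eq0 => /eqP ->; ring.
have E2 x : dform w0 x v0 =
    dform w1 x v1 - dform w1 v0 v1 * w0 x - dform w0 v0 v1 * w1 x.
  apply/eqP; rewrite -subr_eq0; apply/eqP.
  have := i2 x v0 v1; have := i1 x v0 v1; have := i0 x v0 v1.
  rewrite /wedge12 !dformD !faddE e00 e01 e10 e11.
  rewrite [dform w0 v1 x]dformC [dform w1 v1 x]dformC => h0 h1 h2.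
  apply: etrans (etrans _ (congr2 (fun y z => y - z) h2 (congr2 (fun y z => y + z) h0 h1))) _.
  by ring.
  by rewrite addr0 subrr.
exists (contract w0 v0 + dform w1 v0 v1 *: w0); split=> x y.
  by rewrite !faddE !fscaleE /= E0; ring.
by rewrite !faddE !fscaleE /= E1 !E2; ring.
Qed.

End Frame.

(** * Curvature, weights and first integrals of a pencil *)

Section Pencil.
Variables (R : realType) (X : proj_variety R) (w0 w1 th : rform X).
Variables (v0 v1 : vfield X).
Local Notation K := (ratfun X).
Hypotheses (e00 : w0 v0 = 1) (e01 : w0 v1 = 0).
Hypotheses (e10 : w1 v0 = 0) (e11 : w1 v1 = 1).
Hypothesis dw0 : forall x y, dform w0 x y = th x * w0 y - th y * w0 x.
Hypothesis dw1 : forall x y, dform w1 x y = th x * w1 y - th y * w1 x.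

(** From 0 = d(dw) = dtheta /\ w - theta /\ theta /\ w. *)
Lemma connection_curvature (w : rform X) :
  (forall x y, dform w x y = th x * w y - th y * w x) ->
  forall x y z, wedge12 w (dform th) x y z = 0.
Proof.
move=> dw x y z.
have E p q : w (bracket p q) = p (w q) - q (w p) - (th p * w q - th q * w p).
  by rewrite -dw /dform; ring.
rewrite -[RHS](ddform w x y z) !dw !E.
by rewrite /wedge12 /dform !(vappB, vappM); ring.
Qed.

Definition in_ker (u : vfield X) := w0 u = 0 /\ w1 u = 0.

Definition horiz (x : vfield X) : vfield X := x - w0 x *: v0 - w1 x *: v1.

Lemma horizP (x : vfield X) : in_ker (horiz x).
Proof.
by split; rewrite !fappB !fappZ ?e00 ?e01 ?e10 ?e11; ring.
Qed.

Lemma horizE (x : vfield X) (m : K) : x m = w0 x * v0 m + w1 x * v1 m + horiz x m.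
Proof. by rewrite /horiz !(vaddE, voppE, vscaleE); ring. Qed.

(** As a form in x, dtheta(x, u) is a multiple of w0 and also of w1, which are independent. *)
Lemma dth_ker u x : in_ker u -> dform th u x = 0.
Proof.
case=> u0 u1.
have H0 y : dform th y u = - (w0 y * dform th u v0).
  have := connection_curvature dw0 u v0 y; rewrite /wedge12 e00 u0 => /eqP.
  by rewrite mul0r add0r mul1r addr_eq0 => /eqP.
have H1 y : dform th y u = - (w1 y * dform th u v1).
  have := connection_curvature dw1 u v1 y; rewrite /wedge12 e11 u1 => /eqP.
  by rewrite mul0r add0r mul1r addr_eq0 => /eqP.
have H2 : dform th u v0 = 0 by rewrite dformC H1 e10 mul0r !oppr0.
by rewrite dformC H0 H2 mulr0 !oppr0.
Qed.

(** The function f with dtheta = f w0 /\ w1, see [dthE]. *)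
Definition curv : K := dform th v0 v1.

Lemma dthE x y : dform th x y = curv * (w0 x * w1 y - w0 y * w1 x).
Proof.
have := connection_curvature dw0 v0 x y; rewrite /wedge12 e00.
have E z : dform th z v0 = - (w1 z * curv).
  have := connection_curvature dw1 v1 z v0; rewrite /wedge12 e11 e10.
  rewrite -/curv mul0r addr0 mul1r => /eqP; rewrite addr_eq0 => /eqP.
  by [].
rewrite [dform th v0 x]dformC !E => /eqP.
by rewrite mul1r -addrA addr_eq0 => /eqP ->; ring.
Qed.

(** On a kernel field, dw_i = theta /\ w_i determines w_i([u, v0]), so [u, v0] is - theta(u) v0
    modulo the kernel. *)
Lemma ker_bracket0 u : in_ker u -> in_ker (bracket u v0 + th u *: v0).
Proof.
case=> u0 u1; split; rewrite fappD fappZ ?e00 ?e10.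
  have := dw0 u v0; rewrite /dform e00 u0 vapp1 vapp0 => E.
  by move/(congr1 -%R): E; rewrite subrr sub0r opprK => ->; ring.
have := dw1 u v0; rewrite /dform e10 u1 !vapp0 => E.
by move/(congr1 -%R): E; rewrite subrr sub0r opprK => ->; ring.
Qed.

Lemma ker_bracket1 u : in_ker u -> in_ker (bracket u v1 + th u *: v1).
Proof.
case=> u0 u1; split; rewrite fappD fappZ ?e01 ?e11.
  have := dw0 u v1; rewrite /dform e01 u0 !vapp0 => E.
  by move/(congr1 -%R): E; rewrite subrr sub0r opprK => ->; ring.
have := dw1 u v1; rewrite /dform e11 u1 vapp1 vapp0 => E.
by move/(congr1 -%R): E; rewrite subrr sub0r opprK => ->; ring.
Qed.

(* [weight j m] says that dm = - j m theta modulo w0 and w1. *)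
Definition weight (j : nat) (m : K) :=
  forall u, in_ker u -> u m = - (j%:R * th u * m).

Lemma weightM i j x y : weight i x -> weight j y -> weight (i + j) (x * y).
Proof.
by move=> hx hy u hu; rewrite vappM hx // hy // natrD; ring.
Qed.

Lemma weightD j x y : weight j x -> weight j y -> weight j (x + y).
Proof. by move=> hx hy u hu; rewrite vappD hx // hy //; ring. Qed.

Lemma weightN j x : weight j x -> weight j (- x).
Proof. by move=> hx u hu; rewrite vappN hx //; ring. Qed.

Lemma weight_const c : weight 0 (rconst X c).
Proof. by move=> u hu; rewrite vappC; ring. Qed.

Lemma weightZ j c x : weight j x -> weight j (rconst X c * x).
Proof. by rewrite -[j]add0n; apply: weightM (weight_const c). Qed.

Lemma weight_div j x y : weight j x -> weight j y -> weight 0 (x / y).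
Proof.
move=> hx hy u hu; have [->|y0] := eqVneq y 0.
  by rewrite invr0 mulr0 vapp0; ring.
rewrite vapp_div // hx // hy // [Z in Z / _](_ : _ = 0); last by ring.
by rewrite !mul0r oppr0.
Qed.

(** Weight 0 means dg /\ w0 /\ w1 = 0: these functions form the field k of first integrals. *)
Lemma weight0E (x : vfield X) g : weight 0 g -> x g = w0 x * v0 g + w1 x * v1 g.
Proof. by move=> hg; rewrite horizE (hg _ (horizP x)); ring. Qed.

(** Covariant derivative along [v]. Commuting [u] past [v] produces - theta(u) v modulo the kernel,
    hence one more unit of weight; the derivatives of theta cancel since dtheta(u, v) = 0. *)
Lemma weight_nabla (v : vfield X) j m :
  (forall u, in_ker u -> in_ker (bracket u v + th u *: v)) ->
  weight j m -> weight j.+1 (v m + j%:R * th v * m).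
Proof.
move=> hv hm u hu.
have E1 : bracket u v m = - (th u * v m) - j%:R * (th (bracket u v) + th u * th v) * m.
  have /(_ _ (hv u hu)) := hm; rewrite vaddE vscaleE fappD fappZ => /eqP.
  by rewrite -subr_eq0 => /eqP E; rewrite -[RHS]addr0 -E; ring.
have E2 : v (th u) = u (th v) - th (bracket u v).
  by rewrite -[RHS]subr0 -(dth_ker v hu) /dform; ring.
have -> : u (v m + j%:R * th v * m) =
   bracket u v m + v (u m) + j%:R * (u (th v) * m + th v * u m).
  rewrite vappD bracketE -mulrA mulr_natl vappMn vappM -mulr_natl; ring.
rewrite (hm u hu) vappN -mulrA mulr_natl vappMn vappM -mulr_natl E1 E2 -[in RHS]natr1.
by ring.
Qed.

Lemma weight1_v0 m : weight 0 m -> weight 1 (v0 m).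
Proof.
by move/(weight_nabla ker_bracket0); rewrite !mul0r addr0.
Qed.

Lemma weight1_v1 m : weight 0 m -> weight 1 (v1 m).
Proof.
by move/(weight_nabla ker_bracket1); rewrite !mul0r addr0.
Qed.

(** Evaluate d(dtheta) = 0 on (u, v0, v1): each of the brackets of [u] with [v0] and [v1]
    contributes theta(u) f. *)
Lemma weight_curv : weight 2 curv.
Proof.
move=> u hu; have := ddform th u v0 v1.
rewrite !dthE.
have [h1 h2] := ker_bracket0 hu; have [h3 h4] := ker_bracket1 hu.
case: hu => u0 u1.
have E1 : w0 (bracket u v0) = - th u.
  by move/eqP: h1; rewrite fappD fappZ e00 mulr1 addr_eq0 => /eqP.
have E2 : w1 (bracket v1 u) = th u.
  move: h4; rewrite fappD fappZ e11 mulr1 => /eqP; rewrite addr_eq0 => /eqP h.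
  have -> : bracket v1 u = - bracket u v1.
    by apply: vfield_ext => x; rewrite voppE !bracketE; ring.
  by rewrite fappN h opprK.
rewrite e00 e01 e10 e11 u0 u1 E1 E2 !(mul0r, mulr0, mulr1, subr0, vapp0, mul1r).
by move=> H; apply/eqP; rewrite -subr_eq0; apply/eqP; apply: etrans H; ring.
Qed.

(* df + 2 f theta = nabla0 w0 + nabla1 w1 for f = curv. *)
Definition nabla0 := v0 curv + 2 * th v0 * curv.
Definition nabla1 := v1 curv + 2 * th v1 * curv.

Lemma weight_nabla0 : weight 3 nabla0.
Proof. exact: weight_nabla ker_bracket0 weight_curv. Qed.

Lemma weight_nabla1 : weight 3 nabla1.
Proof. exact: weight_nabla ker_bracket1 weight_curv. Qed.

Lemma bracket_frame :
  in_ker (bracket v0 v1 - th v1 *: v0 + th v0 *: v1).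
Proof.
split; rewrite !(fappD, fappN, fappZ) ?e00 ?e01 ?e10 ?e11.
  have := dw0 v0 v1; rewrite /dform e00 e01 vapp1 vapp0 subrr sub0r.
  by move/(congr1 -%R); rewrite opprK => ->; ring.
have := dw1 v0 v1; rewrite /dform e10 e11 vapp1 vapp0 subrr sub0r.
by move/(congr1 -%R); rewrite opprK => ->; ring.
Qed.

(** The kernel part of [v0, v1] acts on f through its weight, and the square term comes from
    dtheta(v0, v1) = f. *)
Lemma curv_identity : v0 nabla1 - v1 nabla0 =
  2 * curv ^+ 2 + 3 * (th v1 * v0 curv - th v0 * v1 curv).
Proof.
have E1 : bracket v0 v1 curv = th v1 * v0 curv - th v0 * v1 curv
   - 2 * curv * (th (bracket v0 v1)).
  have := weight_curv bracket_frame.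
  rewrite !(vaddE, voppE, vscaleE) !(fappD, fappN, fappZ) => /eqP.
  by rewrite -subr_eq0 => /eqP H; rewrite -[RHS]addr0 -H; ring.
have E2 : v0 (th v1) - v1 (th v0) = curv + th (bracket v0 v1).
  by rewrite /curv /dform; ring.
have E3 (v : vfield X) x y : v (2 * x * y) = 2 * (v x * y + x * v y).
  by rewrite -mulrA !mulr_natl vappMn vappM.
rewrite /nabla1 /nabla0 (vappD v0 (v1 curv)) (vappD v1 (v0 curv)) !E3.
have E4 : v0 (v1 curv) = v1 (v0 curv) + bracket v0 v1 curv.
  by rewrite bracketE; ring.
rewrite E4 E1.
have {E2}-> : v0 (th v1) = v1 (th v0) + curv + th (bracket v0 v1).
  by rewrite -[RHS]addrA -E2; ring.
by ring.
Qed.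

Lemma exists_first_integral : curv != 0 ->
  exists h, weight 0 h /\ (v0 h != 0 \/ v1 h != 0).
Proof.
move=> f0; apply: contrapT => noh.
have cst g : weight 0 g -> v0 g = 0 /\ v1 g = 0.
  move=> hg; split; apply/eqP; apply: contrapT => /negP g0; apply: noh.
    by exists g; split=> //; left.
  by exists g; split=> //; right.
(* Constancy of A^2 / f^3 along [v], written as 2 dA/A = 3 df/f without denominators. *)
have key (v : vfield X) A : v (A * A / (curv * curv * curv)) = 0 ->
    2 * curv * v A = 3 * A * v curv.
  rewrite vapp_div ?mulf_neq0 // !vappM => /eqP.
  rewrite mulf_eq0 invr_eq0 !mulf_eq0 (negPf f0) !orbF => /eqP H.
  have [->|A0] := eqVneq A 0; first by rewrite vapp0; ring.
  apply: (mulfI A0); apply: (mulfI f0); apply: (mulfI f0).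
  by apply/eqP; rewrite -subr_eq0; apply/eqP; apply: etrans H; ring.
have w6 A : weight 3 A -> weight 0 (A * A / (curv * curv * curv)).
  move=> hA; apply: (@weight_div 6); first exact: (@weightM 3 3).
  by apply: (@weightM 4 2) weight_curv; apply: (@weightM 2 2) weight_curv; exact: weight_curv.
have [h00 _] := cst _ (w6 _ weight_nabla1).
have [_ h11] := cst _ (w6 _ weight_nabla0).
have k1 := key _ _ h00; have k0 := key _ _ h11.
(* [key] replaces the derivatives of [nabla0] and [nabla1] by those of f in [curv_identity];
   everything but the cubic term cancels. *)
have : 4 * curv ^+ 3 = 0.
  have -> : 4 * curv ^+ 3 = 2 * curv * (v0 nabla1 - v1 nabla0)
     - 6 * curv * (th v1 * v0 curv - th v0 * v1 curv).
    by rewrite curv_identity; ring.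
  by rewrite mulrBr k1 k0 /nabla0 /nabla1; ring.
apply/eqP; rewrite mulf_neq0 ?expf_neq0 //.
exact: natr_ratfun_neq0.
Qed.

(** Derivations dual to three independent first integrals would factor the 3 by 3 identity matrix
    through the two forms w0, w1, hence through rank 2. *)
Lemma weight0_dependent (x : 'I_3 -> K) :
  (forall i, weight 0 (x i)) -> ~ alg_independent x.
Proof.
move=> hx /alg_indep_derivation H.
have /choice [V hV] : forall i, exists v : vfield X, forall j, v (x j) = (i == j)%:R.
  by move=> i; apply: H.
pose A : 'M[K]_(3, 2) := \matrix_(i, j) (if j == 0 then w0 (V i) else w1 (V i)).
pose B : 'M[K]_(2, 3) := \matrix_(j, i) (if j == 0 then v0 (x i) else v1 (x i)).
have AB : A *m B = 1%:M.
  apply/matrixP => i j; rewrite !mxE -hV (weight0E _ (hx j)).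
  by rewrite !big_ord_recr big_ord0 /= add0r !mxE.
by have := mulmx_max_rank A B; rewrite AB mxrank1.
Qed.

Lemma weight0_keval n (x : 'I_n -> K) P :
  (forall i, weight 0 (x i)) -> weight 0 (keval x P).
Proof.
move=> hx; elim/mpoly_ind_ring: P => [c|i|P Q hP hQ|P Q hP hQ].
- by rewrite kevalC; apply: weight_const.
- by rewrite kevalX.
- by rewrite kevalD; apply: weightD.
- by rewrite kevalM; apply: (@weightM 0 0).
Qed.

Lemma reduction_to_surface (g h : K) (F : p1_family R (foliation X)) :
  weight 0 g -> weight 0 h -> v0 g * v1 h <> v1 g * v0 h ->
  (forall s t : R[i], p1_point s t ->
     defines (rconst X s *: w0 + rconst X t *: w1) (F s t)) ->
  exists (Y : proj_variety R) (pi : ratmap X Y) (G : p1_family R (foliation Y)),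
     [/\ dimension Y 2, dominant pi &
         forall s t : R[i], p1_point s t -> is_pullback pi (G s t) (F s t)].
Proof.
move=> hg hh /eqP gh def_F.
have wv0 := weight1_v0; have wv1 := weight1_v1.
set a := v0 g in gh; set b := v1 g in gh; set c := v0 h in gh; set e := v1 h in gh.
have gh0 : a * e - b * c != 0 by rewrite subr_eq0.
have [m [m0 wm]] : exists m, m != 0 /\ weight 1 m.
  have [a0|a0] := eqVneq a 0; last by exists a; split=> //; apply: wv0.
  exists b; split; last exact: wv1.
  by apply: contra_neq gh => ->; rewrite a0 !mul0r.
(* The coefficients of dg and dh in w0, w1 have weight 1; dividing by [m] makes them first
   integrals. *)
pose fs := [:: 1; g; h; a / m; b / m; c / m; e / m].
pose f (i : 'I_7) : K := fs`_i.
have f0 : f ord0 = 1 by [].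
have wf i : weight 0 (f i).
  rewrite /f; case: i => [[|[|[|[|[|[|[|//]]]]]]]] /= _ //.
  - by rewrite -(rmorph1 (rconst X)); apply: weight_const.
  - exact: weight_div (wv0 _ hg) wm.
  - exact: weight_div (wv1 _ hg) wm.
  - exact: weight_div (wv0 _ hh) wm.
  - exact: weight_div (wv1 _ hh) wm.
pose Y := image_variety f0; pose pi := image_map f0.
have wpull (x : ratfun Y) : weight 0 (pull x).
  by apply: (@weight_div 0); apply: weight0_keval.
have dim_up : forall x : 'I_3 -> ratfun Y, ~ alg_independent x.
  move=> x /alg_independent_pull; apply: weight0_dependent => i; exact: wpull.
pose y k : ratfun Y := image_coord f0 (inord k).
have py k : (k < 7)%N -> pull (y k) = fs`_k.
  by move=> k7; rewrite pull_coord /f inordK.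
pose H (i : 'I_2) := y i.+1.
have indH : alg_independent H.
  (* A relation would make dg and dh dependent, but dg /\ dh is [a * e - b * c] times w0 /\ w1. *)
  apply/alg_independent_pull; apply: contrapT => /alg_dep_dfun [d [i di] hd].
  have E (v : vfield X) : d 0 * v g + d 1 * v h = 0.
    rewrite -[RHS](hd v) !big_ord_recr big_ord0 /= add0r.
    rewrite !py //=; congr (d _ * _ + d _ * _); exact/val_inj.
  have d0 : d 0 = 0.
    apply: (mulfI gh0); rewrite mulr0.
    apply: (@etrans _ _ (e * (d 0 * a + d 1 * c) - c * (d 0 * b + d 1 * e))); first by ring.
    by rewrite (E v0) (E v1) !mulr0 subrr.
  have d1 : d 1 = 0.
    apply: (mulfI gh0); rewrite mulr0.
    apply: (@etrans _ _ (a * (d 0 * b + d 1 * e) - b * (d 0 * a + d 1 * c))); first by ring.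
    by rewrite (E v0) (E v1) !mulr0 subrr.
  have : d i = 0 by case: i {di} => [[|[|//]]] p; [rewrite -d0|rewrite -d1]; congr d; apply/val_inj.
  by move/eqP; rewrite (negPf di).
(* By Cramer's rule [P], [Q] pull back to the coefficients in dg, dh of the pencil member scaled by
   [l]; [y 3] to [y 6] are the quotients by [m]. *)
pose P s t := rconst Y s * y 6 - rconst Y t * y 5.
pose Q s t := rconst Y t * y 3 - rconst Y s * y 4.
pose beta s t := P s t *: dfun (y 1) + Q s t *: dfun (y 2).
pose l := (a * e - b * c) / m.
have l0 : l != 0 by rewrite mulf_neq0 ?invr_eq0.
have Ew s t : l *: (rconst X s *: w0 + rconst X t *: w1) =
    pull (P s t) *: dfun g + pull (Q s t) *: dfun h.
  apply: form_ext => x; rewrite !(faddE, fscaleE, dfunE) !pullB !pullM !pullC !py //=.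
  rewrite (weight0E x hg) (weight0E x hh).
  by rewrite -/a -/b -/c -/e /l; ring.
have beta0 s t : p1_point s t -> beta s t <> 0.
  move=> st b0; have [w0' _ _ _] := def_F s t st; apply: w0'.
  (* Derivations dual to [H] read [P] and [Q] off [beta]. *)
  have /choice [V hV] : forall i : 'I_2, exists v : vfield Y, forall j, v (H j) = (i == j)%:R.
    by move=> i; apply: alg_indep_derivation.
  have bV (i : 'I_2) : P s t * (i == 0)%:R + Q s t * (i == 1)%:R = 0.
    by rewrite -(hV i 0) -(hV i 1) -[RHS](fzeroE (V i)) -b0.
  have P0 : P s t = 0 by rewrite -[RHS](bV 0) /=; ring.
  have Q0 : Q s t = 0 by rewrite -[RHS](bV 1) /=; ring.
  have pull0 : pull (0 : ratfun Y) = 0.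
    by rewrite -[in LHS](rmorph0 (rconst Y)) pullC rmorph0.
  move: (Ew s t); rewrite P0 Q0 pull0 !scale0r addr0 => /eqP.
  by rewrite scaler_eq0 (negPf l0) => /eqP.
have pb s t : p1_point s t -> exists G, is_pullback pi G (F s t).
  move=> st.
  have kb : kahler (beta s t).
    exists 2, (fun i => [:: P s t; Q s t]`_i), (fun i => [:: y 1; y 2]`_i).
    by rewrite !big_ord_recr big_ord0 /= add0r.
  have [G hG] := form_foliation (beta0 s t st) (surface_integrable dim_up _ _ _ _) kb.
  exists G, (beta s t), (l *: (rconst X s *: w0 + rconst X t *: w1)); split=> //.
    exists 2, (fun i => [:: P s t; Q s t]`_i), (fun i => [:: y 1; y 2]`_i).
    exists (fun i => pull [:: P s t; Q s t]`_i), (fun i => pull [:: y 1; y 2]`_i).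
    split; first by move=> i; split; apply: pullback_pull.
      by rewrite !big_ord_recr big_ord0 /= add0r.
    by rewrite !big_ord_recr big_ord0 /= add0r !py // Ew.
  exact/definesZ/def_F.
have [G0 _] : exists G, is_pullback pi G (F 1 0).
  by apply: pb; left; apply/eqP/oner_neq0.
(* Choosing G as a function of F s t makes it homogeneous in (s, t). *)
have /choice [sel hsel] : forall F0, exists G,
    (exists G', is_pullback pi G' F0) -> is_pullback pi G F0.
  move=> F0; have [[G hG]|noG] := pselect (exists G, is_pullback pi G F0); first by exists G.
  by exists G0.
have sel_hom k s t : k <> 0 -> sel (F (k * s) (k * t)) = sel (F s t).
  by move=> k0; rewrite p1_hom.
exists Y, pi, (P1Family sel_hom); split.
- by split=> //; exists H.
- exact: image_map_dominant.
by move=> s t st; apply/hsel/pb.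
Qed.

Variables s t : R[i].
Hypothesis st : p1_point s t.
Let w := rconst X s *: w0 + rconst X t *: w1.

Lemma dpencil x y : dform w x y = th x * w y - th y * w x.
Proof.
by rewrite /w dformD !dform_constZ dw0 dw1 !faddE !fscaleE; ring.
Qed.

(** The factor [l] rescales the member to dh when it is a multiple of dh; otherwise it is 1. *)
Lemma affine_pencil :
  (forall g h, weight 0 g -> weight 0 h -> v0 g * v1 h = v1 g * v0 h) ->
  exists l (a : rform X),
    [/\ l != 0, closed_form a & dform (l *: w) = wedge11 (l *: w) a].
Proof.
move=> dep.
have [f0|f0] := eqVneq curv 0.
  exists 1, (- th); split; first exact: oner_neq0.
    move=> x y; rewrite -scaleN1r -(rmorph1 (rconst X)) -rmorphN dform_constZ.
    by rewrite dthE f0; ring.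
  by apply/funext => x; apply/funext => y; rewrite scale1r dpencil /wedge11 !foppE; ring.
have [h [hh h0]] := exists_first_integral f0.
(* The coefficient of dh /\ w on w0 /\ w1; it vanishes exactly when w is proportional to dh. *)
set g := v0 h * rconst X t - v1 h * rconst X s.
have wh (x : vfield X) : x h = w0 x * v0 h + w1 x * v1 h by exact: weight0E.
have [g0|g0] := eqVneq g 0.
  have [l [l0 El]] : exists l, l != 0 /\ l *: w = dfun h.
    move/eqP: g0; rewrite subr_eq0 => /eqP g0.
    have [s0|s0] := eqVneq s 0.
      have t0 : rconst X t != 0.
        by rewrite fmorph_eq0; case: st => /eqP //; rewrite s0 eqxx.
      have v0h : v0 h = 0.
        by apply: (mulIf t0); rewrite g0 s0 rmorph0; ring.
      exists (v1 h / rconst X t); split.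
        by rewrite mulf_neq0 ?invr_eq0 //; case: h0; rewrite ?v0h ?eqxx.
      apply: form_ext => x; rewrite dfunE (wh x) v0h /w fscaleE faddE !fscaleE s0.
      by rewrite rmorph0 mul0r mulr0 !add0r mulrA divfK // mulrC.
    have S0 : rconst X s != 0 by rewrite fmorph_eq0.
    exists (v0 h / rconst X s); split.
      rewrite mulf_neq0 ?invr_eq0 //; case: h0 => //; apply: contraNneq => v0h.
      by apply/eqP/(mulIf S0); rewrite -g0 v0h; ring.
    apply: form_ext => x; rewrite dfunE (wh x) /w fscaleE faddE !fscaleE.
    have ->: v1 h = v0 h / rconst X s * rconst X t.
      by apply: (mulIf S0); rewrite -g0 mulrAC divfK.
    by rewrite mulrDr mulrA divfK //; ring.
  exists l, 0; split=> //.
    by move=> x y; rewrite /dform !fzeroE !vapp0; ring.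
  apply/funext => x; apply/funext => y.
  by rewrite El dform_dfun /wedge11 !fzeroE; ring.
pose D := 2 * (curv * g).
have D0 : D != 0 by rewrite !mulf_neq0 // natr_ratfun_neq0.
(* [c], and [e] below, are the coefficients of dh and w in (df + 2 f theta) / (2 f). Numerator and
   denominator of [c] both have weight 3, so [c] is a first integral. *)
pose c := (nabla0 * rconst X t - nabla1 * rconst X s) / D.
have hv0 := weight1_v0 hh; have hv1 := weight1_v1 hh.
have wD z z' j : weight j z -> weight j z' ->
    weight j (z * rconst X t - z' * rconst X s).
  move=> hz hz'; rewrite ![_ * rconst X _]mulrC.
  by apply: weightD; [exact: weightZ|apply/weightN/weightZ].
have hc : weight 0 c.
  apply: (@weight_div 3); first exact: wD weight_nabla0 weight_nabla1.
  have E : (2 : K) = rconst X 2 by rewrite rmorph_nat.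
  by rewrite /D E; apply/weightZ/(@weightM 2 1); [exact: weight_curv|exact: wD].
pose a := 2^-1 *: (curv^-1 *: dfun curv) - c *: dfun h.
exists 1, a; split; first exact: oner_neq0.
  (* The logarithmic part is closed, and dc /\ dh = 0 since [c] and [h] are first integrals. *)
  move=> x y; have E : (2^-1 : K) = rconst X 2^-1 by rewrite fmorphV rmorph_nat.
  rewrite /a dformD E dform_constZ (closed_dlog f0) -scaleNr dformZ dform_dfun !dfunE.
  rewrite !vappN (weight0E x hc) (weight0E y hc) (wh x) (wh y) !mulr0 addr0 add0r.
  have := dep _ _ hc hh => E2.
  apply: (@etrans _ _ (- ((v0 c * v1 h - v1 c * v0 h) * (w0 x * w1 y - w1 x * w0 y)))).
    by ring.
  by rewrite E2 subrr mul0r oppr0.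
apply/funext => x; apply/funext => y; rewrite scale1r dpencil /wedge11.
pose e := (nabla1 * v0 h - nabla0 * v1 h) / D.
(* The multiple of w drops out of theta /\ w, leaving - a /\ w = w /\ a. *)
have E (z : vfield X) : th z = - a z + e * w z.
  rewrite /a /w !(faddE, foppE, fscaleE, dfunE) (wh z).
  have -> : z curv = w0 z * v0 curv + w1 z * v1 curv
      - 2 * (th z - w0 z * th v0 - w1 z * th v1) * curv.
    by rewrite [LHS]horizE (weight_curv (horizP z)) !fappB !fappZ.
  by apply: pencil_identity => //; exact: natr_ratfun_neq0.
by rewrite !E; ring.
Qed.
End Pencil.

Theorem theorem1 (R : realType) (X : proj_variety R) (smoothX : smooth X)
  (w0 w1 : rform X)
  (w01 : exists v w, wedge11 w0 w1 v w <> 0)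
  (int_w : forall s t : R[i], p1_point s t ->
     integrable (rconst X s *: w0 + rconst X t *: w1))
  (F : p1_family R (foliation X))
  (def_F : forall s t : R[i], p1_point s t ->
     defines (rconst X s *: w0 + rconst X t *: w1) (F s t)) :
  (exists (Y : proj_variety R) (pi : ratmap X Y) (G : p1_family R (foliation Y)),
     [/\ dimension Y 2, dominant pi &
         forall s t : R[i], p1_point s t -> is_pullback pi (G s t) (F s t)]) \/
  (forall s t : R[i], p1_point s t -> transversely_affine (F s t)).
Proof.
have [v0 [v1 [e00 e01 e10 e11]]] := dual_frame w01.
have n01 : (1 : R[i]) <> 0 by apply/eqP/oner_neq0.
have i0 : integrable w0.
  have := int_w 1 0 (or_introl n01).
  by rewrite rmorph1 rmorph0 scale1r scale0r addr0.
have i1 : integrable w1.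
  have := int_w 0 1 (or_intror n01).
  by rewrite rmorph1 rmorph0 scale1r scale0r add0r.
have i2 : integrable (w0 + w1).
  by have := int_w 1 1 (or_introl n01); rewrite rmorph1 !scale1r.
have [th [dw0 dw1]] := common_connection e00 e01 e10 e11 i0 i1 i2.
(* The inequality is dg /\ dh <> 0 written in the dual frame. *)
have [[g [h [hg hh gh]]]|dep] := pselect (exists g h,
  [/\ weight w0 w1 th 0 g, weight w0 w1 th 0 h & v0 g * v1 h <> v1 g * v0 h]).
  by left; apply: (reduction_to_surface e00 e01 e10 e11 dw0 dw1 hg hh gh def_F).
right=> s t st.
have [|l [a [l0 ca da]]] := affine_pencil e00 e01 e10 e11 dw0 dw1 st.
  by move=> g h hg hh; apply: contrapT => gh; apply: dep; exists g, h.
exists (l *: (rconst X s *: w0 + rconst X t *: w1)), a; split=> //.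
exact/definesZ/def_F.
Qed.
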